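(* The Buffer Insertion Problem with $b$ buffer types can be solved optimally in worst-case time $O(bn^2)$, where $n$ is the number of candidate buffer positions. That is, there is an algorithm which, given a routing tree $T=(V,E)$ with source $s_0$, the sink capacitance $C(s)$ and required arrival time $RAT(s)$ for each sink $s$, the capacitance $C(e)$ and resistance $R(e)$ for each edge $e$, a function $f$ specifying the buffer types allowed at each internal vertex, and a buffer library $B$ of size $b$, finds a candidate $\alpha$ for $T$ that maximizes the slack $Q(s_0,\alpha)$, in worst-case time $O(bn^2)$.
   Context: A net is a routing tree $T=(V,E)$ rooted at the source $s_0$, with $V=\{s_0\}\cup V_s\cup V_n$, where $V_s$ is the set of sinks and $V_n$ the set of internal vertices. Each sink $s$ has a capacitance $C(s)$ and a required arrival time $RAT(s)$. Each edge $e$ has lumped resistance $R(e)$ and capacitance $C(e)$. A buffer library $B$ contains $b$ buffer types $B_1,\dots,B_b$, each with intrinsic delay $K(B_i)$, driving resistance $R(B_i)$ and input capacitance $C(B_i)$; the library is supposed sorted by driving resistance in non-increasing order, $R(B_1)\ge R(B_2)\ge\dots\ge R(B_b)$. A function $f:V_n\to 2^B$ specifies the buffer types allowed at each internal vertex. A (candidate) buffer position is an internal vertex at which a buffer may be inserted, i.e. a vertex $v$ with $f(v)\neq\emptyset$; $n$ is the number of buffer positions. For $v\in V$, $T(v)$ is the subtree downstream from $v$, rooted at $v$. A candidate $\alpha$ for $T(v)$ is a decision of where to insert buffers in $T(v)$: each internal vertex $u$ of $T(v)$ receives either no buffer or one buffer of a type in $f(u)$. The load at a vertex $u$ under $\alpha$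 is $C(u)$ if $u$ is a sink, and otherwise the sum over the edges $e=(u,w)$ to the children $w$ of $u$ of $C(e)$ plus the downstream capacitance of $w$ seen from upstream. The downstream capacitance $C(u,\alpha)$ of $u$ seen from upstream is $C(B_i)$ if a buffer of type $B_i$ is inserted at $u$, and is the load at $u$ otherwise. The Elmore delay of an edge $e=(v_i,v_j)$ (signal going from $v_i$ to $v_j$) is $D(e)=R(e)\left(C(e)/2+C(v_j,\alpha)\right)$. The delay $D(v_i)$ of a vertex carrying a buffer of type $B_k$ is $R(B_k)\cdot(\text{load at }v_i)+K(B_k)$, and $D(v_i)=0$ if $v_i$ carries no buffer. The delay from $v$ to a sink $s\in T(v)$ under $\alpha$ is $D(v,s,\alpha)=\sum_{e=(v_i,v_j)}(D(v_i)+D(e))$, summed over the edges on the path from $v$ to $s$. The slack is $Q(v,\alpha)=\min_{s\in T(v)}\{RAT(s)-D(v,s,\alpha)\}$, the minimum being over sinks $s$ in $T(v)$. Buffer Insertion Problem: given a routing tree $T=(V,E)$, the sink capacitance $C(s)$ and required arrival time $RAT(s)$ for each sink $s$, the capacitance $C(e)$ and resistance $R(e)$ for each edge $e$, the function $f$ of allowed buffer types, and the buffer library $B$ (with $K(B_i)$, $R(B_i)$, $C(B_i)$ for each $B_i\in B$), find a candidate $\alpha$ for $T=T(s_0)$ maximizing $Q(s_0,\alpha)$.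
   Formalization: The time bound proved is O(bn^2 + |V| + b log b): reading the tree costs |V| even for n = 0, and ordering the library by input capacitance costs b log b, so the literal O(bn^2) fails. Edge and driving resistances are assumed nonnegative. *)

(* Defs.v *)
From HB Require Import structures.
From mathcomp Require Import all_boot all_order all_algebra.

Set Implicit Arguments.
Unset Strict Implicit.
Unset Printing Implicit Defensive.

Import Order.TTheory GRing.Theory Num.Theory.
Local Open Scope ring_scope.

(** * Nets, candidates and slack *)

Record buffer (R : Type) := Buffer { buf_K : R; buf_R : R; buf_C : R }.
Record edge (R : Type) := Edge { edge_R : R; edge_C : R }.

(* [tree R b] is the type of the subtrees T(v) for v a sink or an internal
   vertex, and [forest R b] is a nonempty list of outgoing edges, each with the
   subtree it leads to.  The leaves are thus exactly the sinks.  A net, being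
   given by the edges leaving its source, is a [forest]. *)
Inductive tree (R : Type) (b : nat) :=
  | Sink (cap rat : R)
  | Internal (f : {set 'I_b}) (ws : forest R b)
with forest (R : Type) (b : nat) :=
  | Last (e : edge R) (w : tree R b)
  | More (e : edge R) (w : tree R b) (ws : forest R b).

Arguments Sink {R b}.
Arguments Internal {R b}.
Arguments Last {R b}.
Arguments More {R b}.

Notation net := forest.

Section Size.
Variables (R : Type) (b : nat).

Fixpoint tree_size (t : tree R b) : nat :=
  match t with
  | Sink _ _ => 1
  | Internal _ ws => (forest_size ws).+1
  end
with forest_size (ws : forest R b) : nat :=
  match ws with
  | Last _ w => tree_size w
  | More _ w ws' => (tree_size w + forest_size ws')%N
  end.

(* |V|, including the source *)
Definition num_vertices (T : net R b) : nat := (forest_size T).+1.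

Fixpoint tree_positions (t : tree R b) : nat :=
  match t with
  | Sink _ _ => 0
  | Internal f ws => ((f != set0) + num_positions ws)%N
  end
with num_positions (ws : forest R b) : nat :=
  match ws with
  | Last _ w => tree_positions w
  | More _ w ws' => (tree_positions w + num_positions ws')%N
  end.

(* The candidates for a given subtree: at each internal vertex, no buffer or a
   buffer of an allowed type. *)
Fixpoint tree_cand (t : tree R b) : Type :=
  match t with
  | Sink _ _ => unit
  | Internal f ws => (option {i : 'I_b | i \in f} * cand ws)%type
  end
with cand (ws : forest R b) : Type :=
  match ws with
  | Last _ w => tree_cand w
  | More _ w ws' => (tree_cand w * cand ws')%type
  end.

End Size.

Section Slack.
Variables (R : realFieldType) (b : nat) (B : 'I_b -> buffer R).

(* [down_cap a] is the downstream capacitance of the root of t seen from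
   upstream; [load a] is the load at the vertex whose outgoing edges are ws. *)
Fixpoint down_cap (t : tree R b) : tree_cand t -> R :=
  match t return tree_cand t -> R with
  | Sink cap _ => fun=> cap
  | Internal f ws => fun a =>
      if a.1 is Some i then buf_C (B (val i)) else load a.2
  end
with load (ws : forest R b) : cand ws -> R :=
  match ws return cand ws -> R with
  | Last e w => fun a => edge_C e + down_cap a
  | More e w ws' => fun a => edge_C e + down_cap a.1 + load a.2
  end.

Definition edge_delay (e : edge R) (c : R) : R :=
  edge_R e * (edge_C e / 2%:R + c).

Definition vertex_delay (f : {set 'I_b}) (o : option {i : 'I_b | i \in f})
    (l : R) : R :=
  if o is Some i then buf_R (B (val i)) * l + buf_K (B (val i)) else 0.

(* One entry for each sink s below v: RAT(s), and the terms D(v_i) + D(e) for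
   the edges e = (v_i, v_j) on the path from v to s.  In [forest_paths d ws a],
   d is the delay D(v) of the vertex v whose outgoing edges are ws. *)
Fixpoint tree_paths (t : tree R b) : tree_cand t -> seq (R * seq R) :=
  match t return tree_cand t -> seq (R * seq R) with
  | Sink _ rat => fun=> [:: (rat, [::])]
  | Internal f ws => fun a =>
      forest_paths (vertex_delay a.1 (load a.2)) a.2
  end
with forest_paths (d : R) (ws : forest R b) : cand ws -> seq (R * seq R) :=
  match ws return cand ws -> seq (R * seq R) with
  | Last e w => fun a =>
      [seq (p.1, d + edge_delay e (down_cap a) :: p.2) | p <- tree_paths a]
  | More e w ws' => fun a =>
      [seq (p.1, d + edge_delay e (down_cap a.1) :: p.2) | p <- tree_paths a.1]
      ++ forest_paths d a.2
  end.

(* Minimum of a nonempty sequence. *)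
Definition seq_min (s : seq R) : R := \big[Num.min/head 0 s]_(x <- s) x.

(* Q(s_0, a); the source carries no buffer, hence D(s_0) = 0. *)
Definition slack (T : net R b) (a : cand T) : R :=
  seq_min [seq p.1 - \sum_(d <- p.2) d | p <- forest_paths 0 a].

Definition optimal (T : net R b) (a : cand T) : Prop :=
  forall a' : cand T, slack a' <= slack a.

End Slack.

Section WellFormed.
Variables (R : realFieldType) (b : nat).

(* Only resistances have to be nonnegative; capacitances, intrinsic delays and
   required arrival times are arbitrary. *)
Fixpoint tree_res_ge0 (t : tree R b) : bool :=
  match t with
  | Sink _ _ => true
  | Internal _ ws => res_ge0 ws
  end
with res_ge0 (ws : forest R b) : bool :=
  match ws with
  | Last e w => (0 <= edge_R e) && tree_res_ge0 w
  | More e w ws' => [&& 0 <= edge_R e, tree_res_ge0 w & res_ge0 ws']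
  end.

Definition sorted_library (B : 'I_b -> buffer R) : Prop :=
  forall i j : 'I_b, (i <= j)%N -> buf_R (B j) <= buf_R (B i).

End WellFormed.

(** * The model of computation *)

(* A program is a finite table of mutually recursive first-order functions of
   one argument, over immutable pointer structures.  Its syntax does not
   mention R: the only real constants are the natural numbers.

   Time is the number of evaluation rules applied, plus the length of each
   array created.  Values are shared, never copied, and the environments of a
   fixed program have bounded length, so that a real RAM (with comparisons and
   field operations on reals, but neither rounding nor access to digits)
   simulates each unit of time in constant time.  Integers can only be
   incremented and compared, so they stay small and cannot encode data. *)
Inductive arith := OpAdd | OpSub | OpMul | OpDiv.

(* Variables are de Bruijn indices.  [Let] binds one variable in its second
   argument, [Unpair] binds the two components of a pair in its second argument
   (the first component being variable 0), and each branch of [Case] binds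
   one variable. *)
Inductive exp :=
  | Var (x : nat)
  | Let (e1 e2 : exp)
  | Call (f : nat) (e : exp)
  | Tt
  | MkPair (e1 e2 : exp)
  | Unpair (e1 e2 : exp)
  | MkInl (e : exp)
  | MkInr (e : exp)
  | Case (e e1 e2 : exp)
  | NatConst (k : nat)
  | NatSucc (e : exp)
  | NatLe (e1 e2 : exp)
  | RealConst (k : nat)
  | RealOp (op : arith) (e1 e2 : exp)
  | RealLe (e1 e2 : exp)
  | MkArray (e : exp)
  | ArrayGet (e1 e2 : exp).

Definition program := seq exp.

Inductive value (R : Type) :=
  | VUnit
  | VPair (v1 v2 : value R)
  | VInl (v : value R)
  | VInr (v : value R)
  | VNat (k : nat)
  | VReal (x : R)
  | VArray (vs : seq (value R)).

Arguments VUnit {R}.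
Arguments VNat {R}.

Definition VBool {R : Type} (c : bool) : value R :=
  if c then VInl VUnit else VInr VUnit.

Definition VList {R : Type} (vs : seq (value R)) : value R :=
  foldr (fun v l => VInr (VPair v l)) (VInl VUnit) vs.

Section Eval.
Variables (R : realFieldType) (P : program).

(* As usual, x / 0 = 0. *)
Definition eval_arith (op : arith) (x y : R) : R :=
  match op with
  | OpAdd => x + y
  | OpSub => x - y
  | OpMul => x * y
  | OpDiv => x / y
  end.

(* [eval env e v t]: in the environment env, e evaluates to v in time t. *)
Inductive eval : seq (value R) -> exp -> value R -> nat -> Prop :=
  | EvVar env x v : onth env x = Some v -> eval env (Var x) v 1
  | EvLet env e1 e2 v1 v t1 t2 :
      eval env e1 v1 t1 -> eval (v1 :: env) e2 v t2 ->
      eval env (Let e1 e2) v (t1 + t2).+1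
  | EvCall env f e body v1 v t1 t2 :
      onth P f = Some body -> eval env e v1 t1 -> eval [:: v1] body v t2 ->
      eval env (Call f e) v (t1 + t2).+1
  | EvTt env : eval env Tt VUnit 1
  | EvPair env e1 e2 v1 v2 t1 t2 :
      eval env e1 v1 t1 -> eval env e2 v2 t2 ->
      eval env (MkPair e1 e2) (VPair v1 v2) (t1 + t2).+1
  | EvUnpair env e1 e2 v1 v2 v t1 t2 :
      eval env e1 (VPair v1 v2) t1 -> eval [:: v1, v2 & env] e2 v t2 ->
      eval env (Unpair e1 e2) v (t1 + t2).+1
  | EvInl env e v t : eval env e v t -> eval env (MkInl e) (VInl v) t.+1
  | EvInr env e v t : eval env e v t -> eval env (MkInr e) (VInr v) t.+1
  | EvCaseL env e e1 e2 v1 v t1 t2 :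
      eval env e (VInl v1) t1 -> eval (v1 :: env) e1 v t2 ->
      eval env (Case e e1 e2) v (t1 + t2).+1
  | EvCaseR env e e1 e2 v1 v t1 t2 :
      eval env e (VInr v1) t1 -> eval (v1 :: env) e2 v t2 ->
      eval env (Case e e1 e2) v (t1 + t2).+1
  | EvNatConst env k : eval env (NatConst k) (VNat k) 1
  | EvNatSucc env e k t :
      eval env e (VNat k) t -> eval env (NatSucc e) (VNat k.+1) t.+1
  | EvNatLe env e1 e2 k1 k2 t1 t2 :
      eval env e1 (VNat k1) t1 -> eval env e2 (VNat k2) t2 ->
      eval env (NatLe e1 e2) (VBool (k1 <= k2)%N) (t1 + t2).+1
  | EvRealConst env k : eval env (RealConst k) (VReal k%:R) 1
  | EvRealOp env op e1 e2 x1 x2 t1 t2 :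
      eval env e1 (VReal x1) t1 -> eval env e2 (VReal x2) t2 ->
      eval env (RealOp op e1 e2) (VReal (eval_arith op x1 x2)) (t1 + t2).+1
  | EvRealLe env e1 e2 x1 x2 t1 t2 :
      eval env e1 (VReal x1) t1 -> eval env e2 (VReal x2) t2 ->
      eval env (RealLe e1 e2) (VBool (x1 <= x2)) (t1 + t2).+1
  | EvArray env e vs t :
      eval env e (VList vs) t ->
      eval env (MkArray e) (VArray vs) (t + size vs).+1
  | EvGet env e1 e2 vs k v t1 t2 :
      eval env e1 (VArray vs) t1 -> eval env e2 (VNat k) t2 ->
      onth vs k = Some v ->
      eval env (ArrayGet e1 e2) v (t1 + t2).+1.

(* The entry point is function 0. *)
Definition runs (input output : value R) (t : nat) : Prop :=
  eval [:: input] (Call 0 (Var 0)) output t.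

End Eval.

Lemma VList_inj (R : Type) : injective (@VList R).
Proof. by elim=> [|v s IHs] [|v' s'] //= [-> /IHs->]. Qed.

(* Evaluation is deterministic: the output and the time are functions of the
   program and its input. *)
Lemma eval_det (R : realFieldType) (P : program) (env : seq (value R)) (e : exp)
    (v v' : value R) (t t' : nat) :
  eval P env e v t -> eval P env e v' t' -> v = v' /\ t = t'.
Proof.
move=> ev; elim: ev v' t' => {env e v t}; intros;
  match goal with H : eval _ _ _ _ _ |- _ => inversion H; subst; clear H end;
  repeat match goal with
  | H : onth ?s ?k = Some _, H' : onth ?s ?k = Some _ |- _ =>
      rewrite H in H'; case: H' => H'; subst
  | IH : forall v t, eval _ ?env ?e v t -> _, H : eval _ ?env ?e _ _ |- _ =>
      let E := fresh "E" in
      case: (IH _ _ H) => E ?; clear IH H;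
      try (apply VList_inj in E); try (injection E; intros); subst
  end; first [by [] | congruence].
Qed.

(** * Encoding of the input and of the output *)

Section Encoding.
Variables (R : Type) (b : nat).

Definition encode_buffer (B : buffer R) : value R :=
  VPair (VReal (buf_K B)) (VPair (VReal (buf_R B)) (VReal (buf_C B))).

Definition encode_library (B : 'I_b -> buffer R) : value R :=
  VList [seq encode_buffer (B i) | i <- enum 'I_b].

(* f(v) is listed in increasing order of indices. *)
Definition encode_set (f : {set 'I_b}) : value R :=
  VList [seq VNat (val i) | i <- enum f].

Definition encode_edge (e : edge R) : value R :=
  VPair (VReal (edge_R e)) (VReal (edge_C e)).

Fixpoint encode_tree (t : tree R b) : value R :=
  match t with
  | Sink cap rat => VInl (VPair (VReal cap) (VReal rat))
  | Internal f ws => VInr (VPair (encode_set f) (VList (encode_forest ws)))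
  end
with encode_forest (ws : forest R b) : seq (value R) :=
  match ws with
  | Last e w => [:: VPair (encode_edge e) (encode_tree w)]
  | More e w ws' =>
      VPair (encode_edge e) (encode_tree w) :: encode_forest ws'
  end.

Definition encode_input (B : 'I_b -> buffer R) (T : net R b) : value R :=
  VPair (encode_library B) (VList (encode_forest T)).

Definition encode_choice (f : {set 'I_b}) (o : option {i : 'I_b | i \in f}) :
    value R :=
  if o is Some i then VInr (VNat (val (val i))) else VInl VUnit.

(* A candidate is output as a tree of the same shape as the net. *)
Fixpoint encode_tree_cand (t : tree R b) : tree_cand t -> value R :=
  match t return tree_cand t -> value R with
  | Sink _ _ => fun=> VUnit
  | Internal f ws => fun a =>
      VPair (encode_choice a.1) (VList (encode_cands a.2))
  end
with encode_cands (ws : forest R b) : cand ws -> seq (value R) :=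
  match ws return cand ws -> seq (value R) with
  | Last e w => fun a => [:: encode_tree_cand a]
  | More e w ws' => fun a => encode_tree_cand a.1 :: encode_cands a.2
  end.

Definition encode_cand (T : net R b) (a : cand T) : value R :=
  VList (encode_cands a).

End Encoding.

(* Main.v *)
Require Import Defs.
From HB Require Import structures.
From mathcomp Require Import all_boot all_order all_algebra.
From mathcomp Require Import zify ring lra.

(** A candidate matters only through its slack q and its downstream capacitance
    c, so the candidates of a subtree with n positions are represented, up to
    domination, by a list of at most b n + 1 pairs (q, c) sorted by c.  Below a
    buffer of resistance r the best candidate maximizes q - r c: it is the
    lowest at r of the lines c x - q.  As the library is sorted by resistance,
    one walk along the lower envelope of these lines serves all buffers, in
    time O(b n).  Two branches are combined by walking along both lists and
    advancing in the one with the smaller slack.  A net has at most 2 n - 1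
    positions and branchings of this kind.

    All other vertices are treated in constant time.  Edges, and branches
    without positions, act on a list by
      (q, c) |-> (min(q, g(c)) + s c - d, c + c0)
    where g is the minimum of some lines.  The list is left alone and g, s, d,
    c0 are updated instead; the slopes of the lines of g appear in monotone
    order, so that g is evaluated along the list by the same envelope walk. *)

Set Implicit Arguments.
Unset Strict Implicit.
Unset Printing Implicit Defensive.

Import Order.TTheory GRing.Theory Num.Theory.
Local Open Scope ring_scope.

(** * The program *)

(* Higher-order abstract syntax: an expression is a function of the length of
   its environment, and a variable is known by its position from the bottom of
   the environment. *)
Definition hexp := nat -> exp.
Definition hvar (l : nat) : hexp := fun d => Var (d - l.+1).
Definition hlet (e : hexp) (k : hexp -> hexp) : hexp :=
  fun d => Let (e d) (k (hvar d) d.+1).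
Definition hunpair (e : hexp) (k : hexp -> hexp -> hexp) : hexp :=
  fun d => Unpair (e d) (k (hvar d.+1) (hvar d) d.+2).
Definition hcase (e : hexp) (k1 k2 : hexp -> hexp) : hexp :=
  fun d => Case (e d) (k1 (hvar d) d.+1) (k2 (hvar d) d.+1).
Definition hcall (f : nat) (e : hexp) : hexp := fun d => Call f (e d).
Definition htt : hexp := fun=> Tt.
Definition hpair (e1 e2 : hexp) : hexp := fun d => MkPair (e1 d) (e2 d).
Definition hinl (e : hexp) : hexp := fun d => MkInl (e d).
Definition hinr (e : hexp) : hexp := fun d => MkInr (e d).
Definition hnat (k : nat) : hexp := fun=> NatConst k.
Definition hsucc (e : hexp) : hexp := fun d => NatSucc (e d).
Definition hnatle (e1 e2 : hexp) : hexp := fun d => NatLe (e1 d) (e2 d).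
Definition hzero : hexp := fun=> RealConst 0.
Definition hop (op : arith) (e1 e2 : hexp) : hexp :=
  fun d => RealOp op (e1 d) (e2 d).
Definition hle (e1 e2 : hexp) : hexp := fun d => RealLe (e1 d) (e2 d).
Definition harray (e : hexp) : hexp := fun d => MkArray (e d).
Definition hget (e1 e2 : hexp) : hexp := fun d => ArrayGet (e1 d) (e2 d).

Definition hnil : hexp := hinl htt.
Definition hcons (x l : hexp) : hexp := hinr (hpair x l).
Definition hlist (l e : hexp) (k : hexp -> hexp -> hexp) : hexp :=
  hcase l (fun=> e) (fun p => hunpair p k).
Definition hif (c e1 e2 : hexp) : hexp := hcase c (fun=> e1) (fun=> e2).
Definition htriple (e : hexp) (k : hexp -> hexp -> hexp -> hexp) : hexp :=
  hunpair e (fun x yz => hunpair yz (fun y z => k x y z)).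
Definition func (k : hexp -> hexp) : exp := k (hvar 0) 1.
Definition func2 (k : hexp -> hexp -> hexp) : exp :=
  func (fun x => hunpair x k).

Declare Scope hexp_scope.
Delimit Scope hexp_scope with H.
Bind Scope hexp_scope with hexp.
Notation "'LET' x ':=' e 'IN' k" := (hlet e%H (fun x => k%H))
  (at level 200, x name, k at level 200) : hexp_scope.
Notation "'LET' ( x , y ) ':=' e 'IN' k" := (hunpair e%H (fun x y => k%H))
  (at level 200, x name, y name, k at level 200) : hexp_scope.
Notation "'LET' ( x , y , z ) ':=' e 'IN' k" :=
  (htriple e%H (fun x y z => k%H))
  (at level 200, x name, y name, z name, k at level 200) : hexp_scope.
Notation "'IF' c 'THEN' e1 'ELSE' e2" := (hif c%H e1%H e2%H)
  (at level 200, e1 at level 200, e2 at level 200) : hexp_scope.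
Notation "'LIST' l 'NIL' => e1 'CONS' ( x , xs ) => e2" :=
  (hlist l%H e1%H (fun x xs => e2%H))
  (at level 200, x name, xs name, e1 at level 200, e2 at level 200) :
  hexp_scope.
Notation "'CASE' e 'INL' x => e1 'INR' y => e2" :=
  (hcase e%H (fun x => e1%H) (fun y => e2%H))
  (at level 200, x name, y name, e1 at level 200, e2 at level 200) : hexp_scope.
Notation "x + y" := (hop OpAdd x y) : hexp_scope.
Notation "x - y" := (hop OpSub x y) : hexp_scope.
Notation "x * y" := (hop OpMul x y) : hexp_scope.
Notation "x / y" := (hop OpDiv x y) : hexp_scope.
Notation "x <= y" := (hle x y) : hexp_scope.
Notation "x :: y" := (hcons x y) : hexp_scope.
Notation "( x , y , .. , z )" := (hpair .. (hpair x y) .. z) : hexp_scope.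

Definition f_split := 1%N.
Definition f_merge := 2%N.
Definition f_sort := 3%N.
Definition f_keys := 4%N.
Definition f_push := 5%N.
Definition f_hull := 6%N.
Definition f_advance := 7%N.
Definition f_cut := 8%N.
Definition f_force := 9%N.
Definition f_edge := 10%N.
Definition f_join := 11%N.
Definition f_union := 12%N.
Definition f_lines := 13%N.
Definition f_buffered := 14%N.
Definition f_collect := 15%N.
Definition f_unbuffered := 16%N.
Definition f_position := 17%N.
Definition f_tree := 18%N.
Definition f_forest := 19%N.
Definition f_best := 20%N.
Definition f_flatten := 21%N.
Definition f_tree_cand := 22%N.
Definition f_forest_cand := 23%N.

Definition hlev (l x : hexp) : hexp := (LET (a, s, u) := l IN a + s * x)%H.

Definition main_body : exp := Eval compute in
  func2 (fun lib net =>
    LET order := hcall f_sort (hcall f_keys (lib, hnat 0)) IN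
    LET s := hcall f_forest ((lib, order), net) IN
    LIST hcall f_force s
    NIL => htt
    CONS (x, xs) =>
      LET (q, c, p) := hcall f_best (x, xs) IN
      LET (a, l) := hcall f_forest_cand (net, hcall f_flatten (p, hnil)) IN
      a)%H.

Definition split_body : exp := Eval compute in
  func (fun l =>
    LIST l
    NIL => (l, l)
    CONS (x, xs) =>
      LET (l1, l2) := hcall f_split xs IN
      (x :: l2, l1))%H.

Definition merge_body : exp := Eval compute in
  func2 (fun l1 l2 =>
    LIST l1
    NIL => l2
    CONS (x1, xs1) =>
      LIST l2
      NIL => l1
      CONS (x2, xs2) =>
        LET (q1, c1, p1) := x1 IN
        LET (q2, c2, p2) := x2 IN
        IF c1 <= c2 THEN x1 :: hcall f_merge (xs1, l2)
        ELSE x2 :: hcall f_merge (l1, xs2))%H.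

Definition sort_body : exp := Eval compute in
  func (fun l =>
    LIST l
    NIL => l
    CONS (x, xs) =>
      LIST xs
      NIL => l
      CONS (y, ys) =>
        LET (l1, l2) := hcall f_split l IN
        hcall f_merge (hcall f_sort l1, hcall f_sort l2))%H.

Definition keys_body : exp := Eval compute in
  func2 (fun lib i =>
    LIST lib
    NIL => lib
    CONS (bf, lib') =>
      LET (k, r, c) := bf IN
      (htt, (c, i)) :: hcall f_keys (lib', hsucc i))%H.

Definition push_body : exp := Eval compute in
  func2 (fun l h =>
    LIST h
    NIL => l :: h
    CONS (l1, h') =>
      LET (a, s, u) := l IN
      LET (a1, s1, u1) := l1 IN
      IF s1 <= s THEN
        IF a1 <= a THEN h ELSE hcall f_push (l, h')
      ELSE
        LIST h'
        NIL => l :: h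
        CONS (l2, h'') =>
          LET (a2, s2, u2) := l2 IN
          IF (a - a1) * (s2 - s1) <= (a1 - a2) * (s1 - s)
          THEN hcall f_push (l, h')
          ELSE l :: h)%H.

Definition hull_body : exp := Eval compute in
  func (fun l =>
    LIST l
    NIL => l
    CONS (x, xs) => hcall f_push (x, hcall f_hull xs))%H.

Definition advance_body : exp := Eval compute in
  func2 (fun x h =>
    LIST h
    NIL => h
    CONS (l1, h1) =>
      LIST h1
      NIL => h
      CONS (l2, h2) =>
        IF hlev l2 x <= hlev l1 x THEN hcall f_advance (x, h1) ELSE h)%H.

Definition cut_body : exp := Eval compute in
  func (fun arg =>
    LET (l, h, w) := arg IN
    LIST l
    NIL => l
    CONS (x, l') =>
      LET (q, c, p) := x IN
      LET (s, d, c0) := w IN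
      LET y := hzero - c IN
      LET h1 := hcall f_advance (y, h) IN
      LET q1 :=
        LIST h1
        NIL => q
        CONS (l1, h2) => LET g := hlev l1 y IN IF q <= g THEN q ELSE g
      IN
      (q1 + s * c - d, (c + c0, p)) :: hcall f_cut (l', (h1, w)))%H.

Definition force_body : exp := Eval compute in
  func (fun s =>
    CASE s
    INL qc => LET (q, c) := qc IN (q, (c, hnil)) :: hnil
    INR m =>
      LET (l, ls, w) := m IN
      hcall f_cut (l, (hcall f_hull ls, w)))%H.

Definition edge_body : exp := Eval compute in
  func2 (fun e z =>
    LET (re, ce) := e IN
    LET h := ce / (fun=> RealConst 2) IN
    CASE z
    INL qc => LET (q, c) := qc IN hinl (q - re * (h + c), ce + c)
    INR m =>
      LET (l, ls, w) := m IN
      LET (s, d, c) := w IN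
      hinr (l, (ls, (s - re, (d + re * (h + c), ce + c)))))%H.

Definition join_body : exp := Eval compute in
  func2 (fun l1 l2 =>
    LIST l1
    NIL => l1
    CONS (x1, xs1) =>
      LIST l2
      NIL => l2
      CONS (x2, xs2) =>
        LET (q1, c1, p1) := x1 IN
        LET (q2, c2, p2) := x2 IN
        LET c := c1 + c2 IN
        LET p := hinr (hinr (p1, p2)) IN
        IF q1 <= q2 THEN (q1, (c, p)) :: hcall f_join (xs1, l2)
        ELSE (q2, (c, p)) :: hcall f_join (l1, xs2))%H.

Definition hcap (q0 c0 m : hexp) : hexp :=
  (LET (l, ls, w) := m IN
   LET (s, d, c) := w IN
   hinr (l, ((q0 + d, (s, htt)) :: ls, (s, (d, c + c0)))))%H.

Definition union_body : exp := Eval compute in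
  func2 (fun z1 z2 =>
    CASE z1
    INL qc1 =>
      LET (q1, c1) := qc1 IN
      CASE z2
      INL qc2 =>
        LET (q2, c2) := qc2 IN
        hinl (IF q1 <= q2 THEN q1 ELSE q2, c1 + c2)
      INR m2 => hcap q1 c1 m2
    INR m1 =>
      CASE z2
      INL qc2 => LET (q2, c2) := qc2 IN hcap q2 c2 m1
      INR m2 =>
        hinr (hcall f_join (hcall f_force z1, hcall f_force z2),
              (hnil, (hzero, (hzero, hzero)))))%H.

Definition lines_body : exp := Eval compute in
  func (fun l =>
    LIST l
    NIL => l
    CONS (x, l') =>
      LET (q, c, p) := x IN
      (hzero - q, (c, p)) :: hcall f_lines l')%H.

Definition buffered_body : exp := Eval compute in
  func (fun arg =>
    LET (lib, w) := arg IN
    LET (f, i, h) := w IN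
    LIST lib
    NIL => lib
    CONS (bf, lib') =>
      LIST f
      NIL => hnil :: hcall f_buffered (lib', (f, (hsucc i, h)))
      CONS (j, f') =>
        IF hnatle j i THEN
          LET (k, r, c) := bf IN
          LET h1 := hcall f_advance (r, h) IN
          LIST h1
          NIL => htt
          CONS (l1, h2) =>
            LET (a, s, p) := l1 IN
            hinr (hzero - hlev l1 r - k, (c, hinr (hinl (hinr i, p))))
            :: hcall f_buffered (lib', (f', (hsucc i, h1)))
        ELSE hnil :: hcall f_buffered (lib', (f, (hsucc i, h))))%H.

Definition collect_body : exp := Eval compute in
  func2 (fun order arr =>
    LIST order
    NIL => order
    CONS (key, order') =>
      LET (u, c, i) := key IN
      LET l := hcall f_collect (order', arr) IN
      CASE hget arr i
      INL u => l
      INR x => x :: l)%H.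

Definition unbuffered_body : exp := Eval compute in
  func (fun l =>
    LIST l
    NIL => l
    CONS (x, l') =>
      LET (q, c, p) := x IN
      (q, (c, hinr (hinl (hnil, p)))) :: hcall f_unbuffered l')%H.

(* The envelope is queried in order of resistance, but the new items must come
   in order of capacitance: they go through an array indexed by the library. *)
Definition position_body : exp := Eval compute in
  func (fun arg =>
    LET (ctx, f, z) := arg IN
    LET (lib, order) := ctx IN
    LET l := hcall f_force z IN
    LET h := hcall f_hull (hcall f_lines l) IN
    LET arr := harray (hcall f_buffered (lib, (f, (hnat 0, h)))) IN
    hinr (hcall f_merge (hcall f_unbuffered l, hcall f_collect (order, arr)),
          (hnil, (hzero, (hzero, hzero)))))%H.

Definition tree_body : exp := Eval compute in
  func2 (fun ctx t =>
    CASE t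
    INL sink => LET (c, q) := sink IN hinl (q, c)
    INR v =>
      LET (f, ws) := v IN
      LET z := hcall f_forest (ctx, ws) IN
      LIST f
      NIL => z
      CONS (i, f') => hcall f_position (ctx, (f, z)))%H.

Definition forest_body : exp := Eval compute in
  func2 (fun ctx ws =>
    LIST ws
    NIL => htt
    CONS (ew, ws') =>
      LET (e, w) := ew IN
      LET z := hcall f_edge (e, hcall f_tree (ctx, w)) IN
      LIST ws'
      NIL => z
      CONS (u, ws'') => hcall f_union (z, hcall f_forest (ctx, ws')))%H.

Definition best_body : exp := Eval compute in
  func2 (fun x l =>
    LIST l
    NIL => x
    CONS (y, l') =>
      LET (q1, c1, p1) := x IN
      LET (q2, c2, p2) := y IN
      IF q1 <= q2 THEN hcall f_best (y, l') ELSE hcall f_best (x, l'))%H.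

Definition flatten_body : exp := Eval compute in
  func2 (fun p l =>
    CASE p
    INL u => l
    INR p' =>
      CASE p'
      INL cp => LET (o, p1) := cp IN o :: hcall f_flatten (p1, l)
      INR p12 =>
        LET (p1, p2) := p12 IN
        hcall f_flatten (p1, hcall f_flatten (p2, l)))%H.

Definition tree_cand_body : exp := Eval compute in
  func2 (fun t l =>
    CASE t
    INL sink => (htt, l)
    INR v =>
      LET (f, ws) := v IN
      LIST f
      NIL =>
        LET (a, l') := hcall f_forest_cand (ws, l) IN ((hnil, a), l')
      CONS (i, f') =>
        LIST l
        NIL => htt
        CONS (o, l1) =>
          LET (a, l') := hcall f_forest_cand (ws, l1) IN ((o, a), l'))%H.

Definition forest_cand_body : exp := Eval compute in
  func2 (fun ws l =>
    LIST ws
    NIL => htt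
    CONS (ew, ws') =>
      LET (e, w) := ew IN
      LET (a, l1) := hcall f_tree_cand (w, l) IN
      LIST ws'
      NIL => (a :: hnil, l1)
      CONS (u, ws'') =>
        LET (as', l2) := hcall f_forest_cand (ws', l1) IN (a :: as', l2))%H.

Definition buffer_insertion : program :=
  [:: main_body; split_body; merge_body; sort_body; keys_body; push_body;
      hull_body; advance_body; cut_body; force_body; edge_body; join_body;
      union_body; lines_body; buffered_body; collect_body; unbuffered_body;
      position_body; tree_body; forest_body; best_body; flatten_body;
      tree_cand_body; forest_cand_body].

(** * Evaluation with time bounds *)

Section Bounded.
Variable R : realFieldType.
Implicit Types (env : seq (value R)) (v w : value R).

Definition runs_in env e v n :=
  exists2 t, eval buffer_insertion env e v t & (t <= n)%N.

Lemma runs_in_le env e v m n :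
  runs_in env e v m -> (m <= n)%N -> runs_in env e v n.
Proof. by case=> t ev le_tm le_mn; exists t; rewrite // (leq_trans le_tm). Qed.

Lemma runs_in_eq env e v v' m n :
  runs_in env e v' m -> v' = v -> (m <= n)%N -> runs_in env e v n.
Proof. by move=> run <-; apply: runs_in_le. Qed.

Lemma runs_in_var env x v : onth env x = Some v -> runs_in env (Var x) v 1.
Proof. by exists 1%N => //; exact: EvVar. Qed.

Lemma runs_in_let env e1 e2 v1 v n1 n2 :
  runs_in env e1 v1 n1 -> runs_in (v1 :: env) e2 v n2 ->
  runs_in env (Let e1 e2) v (n1 + n2).+1.
Proof.
by move=> [t1 ev1 le1] [t2 ev2 le2]; exists (t1 + t2).+1;
  [exact: EvLet ev1 ev2 | lia].
Qed.

Lemma runs_in_call env f e body v1 v n1 n2 :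
  onth buffer_insertion f = Some body -> runs_in env e v1 n1 ->
  runs_in [:: v1] body v n2 -> runs_in env (Call f e) v (n1 + n2).+1.
Proof.
by move=> Pf [t1 ev1 le1] [t2 ev2 le2]; exists (t1 + t2).+1;
  [exact: EvCall Pf ev1 ev2 | lia].
Qed.

Lemma runs_in_tt env : runs_in env Tt VUnit 1.
Proof. by exists 1%N => //; exact: EvTt. Qed.

Lemma runs_in_pair env e1 e2 v1 v2 n1 n2 :
  runs_in env e1 v1 n1 -> runs_in env e2 v2 n2 ->
  runs_in env (MkPair e1 e2) (VPair v1 v2) (n1 + n2).+1.
Proof.
by move=> [t1 ev1 le1] [t2 ev2 le2]; exists (t1 + t2).+1;
  [exact: EvPair | lia].
Qed.

Definition runs_unpair env e v n v1 :=
  if v1 is VPair v2 v3 then runs_in [:: v2, v3 & env] e v n else False.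

Lemma runs_in_unpair env e1 e2 v1 v n1 n2 :
  runs_in env e1 v1 n1 -> runs_unpair env e2 v n2 v1 ->
  runs_in env (Unpair e1 e2) v (n1 + n2).+1.
Proof.
case: v1 => //= v1 v2 [t1 ev1 le1] [t2 ev2 le2].
by exists (t1 + t2).+1; [exact: EvUnpair ev1 ev2 | lia].
Qed.

Lemma runs_in_inl env e v n :
  runs_in env e v n -> runs_in env (MkInl e) (VInl v) n.+1.
Proof. by move=> [t ev le]; exists t.+1; [exact: EvInl | lia]. Qed.

Lemma runs_in_inr env e v n :
  runs_in env e v n -> runs_in env (MkInr e) (VInr v) n.+1.
Proof. by move=> [t ev le]; exists t.+1; [exact: EvInr | lia]. Qed.

Definition runs_case env e1 e2 v n v1 :=
  match v1 with
  | VInl v1 => runs_in (v1 :: env) e1 v n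
  | VInr v1 => runs_in (v1 :: env) e2 v n
  | _ => False
  end.

Lemma runs_in_case env e e1 e2 v1 v n1 n2 :
  runs_in env e v1 n1 -> runs_case env e1 e2 v n2 v1 ->
  runs_in env (Case e e1 e2) v (n1 + n2).+1.
Proof.
by case: v1 => //= v1 [t1 ev1 le1] [t2 ev2 le2]; exists (t1 + t2).+1;
  try lia; [exact: EvCaseL ev1 ev2 | exact: EvCaseR ev1 ev2].
Qed.

Lemma runs_in_nat env k : runs_in env (NatConst k) (VNat k) 1.
Proof. by exists 1%N => //; exact: EvNatConst. Qed.

Lemma runs_in_succ env e k n :
  runs_in env e (VNat k) n -> runs_in env (NatSucc e) (VNat k.+1) n.+1.
Proof. by move=> [t ev le]; exists t.+1; [exact: EvNatSucc | lia]. Qed.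

Lemma runs_in_natle env e1 e2 k1 k2 n1 n2 :
  runs_in env e1 (VNat k1) n1 -> runs_in env e2 (VNat k2) n2 ->
  runs_in env (NatLe e1 e2) (VBool (k1 <= k2)%N) (n1 + n2).+1.
Proof.
by move=> [t1 ev1 le1] [t2 ev2 le2]; exists (t1 + t2).+1;
  [exact: EvNatLe | lia].
Qed.

Lemma runs_in_real env k : runs_in env (RealConst k) (VReal k%:R) 1.
Proof. by exists 1%N => //; exact: EvRealConst. Qed.

Lemma runs_in_op env op e1 e2 x1 x2 n1 n2 :
  runs_in env e1 (VReal x1) n1 -> runs_in env e2 (VReal x2) n2 ->
  runs_in env (RealOp op e1 e2) (VReal (eval_arith op x1 x2)) (n1 + n2).+1.
Proof.
by move=> [t1 ev1 le1] [t2 ev2 le2]; exists (t1 + t2).+1;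
  [exact: EvRealOp | lia].
Qed.

Lemma runs_in_le_real env e1 e2 x1 x2 n1 n2 :
  runs_in env e1 (VReal x1) n1 -> runs_in env e2 (VReal x2) n2 ->
  runs_in env (RealLe e1 e2) (VBool (x1 <= x2)) (n1 + n2).+1.
Proof.
by move=> [t1 ev1 le1] [t2 ev2 le2]; exists (t1 + t2).+1;
  [exact: EvRealLe | lia].
Qed.

Lemma runs_in_array env e vs n :
  runs_in env e (VList vs) n ->
  runs_in env (MkArray e) (VArray vs) (n + size vs).+1.
Proof.
by move=> [t ev le]; exists (t + size vs).+1; [exact: EvArray | lia].
Qed.

Lemma runs_in_get env e1 e2 vs k v n1 n2 :
  runs_in env e1 (VArray vs) n1 -> runs_in env e2 (VNat k) n2 ->
  onth vs k = Some v -> runs_in env (ArrayGet e1 e2) v (n1 + n2).+1.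
Proof.
by move=> [t1 ev1 le1] [t2 ev2 le2] vsk; exists (t1 + t2).+1;
  [exact: EvGet ev1 ev2 vsk | lia].
Qed.

End Bounded.

(* The hypotheses of the context supply the results of the comparisons and of
   the calls. *)
Ltac run_reduce :=
  repeat match goal with
  | H : (_ <= _) = _ |- context [VBool _] => rewrite H
  | H : (_ <= _)%N = _ |- context [VBool _] => rewrite H
  | H : is_true (_ <= _) |- context [VBool _] => rewrite H
  | H : is_true (_ <= _)%N |- context [VBool _] => rewrite H
  end; cbn [VBool eval_arith runs_case runs_unpair].

Ltac run :=
  lazymatch goal with
  | |- runs_in _ (Var _) _ _ => apply: runs_in_var; reflexivity
  | |- runs_in _ (Let _ _) _ _ => eapply runs_in_let; [run | run]
  | |- runs_in _ (Call _ _) _ _ =>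
      eapply runs_in_call; [reflexivity | run | run_call]
  | |- runs_in _ Tt _ _ => apply: runs_in_tt
  | |- runs_in _ (MkPair _ _) _ _ => eapply runs_in_pair; [run | run]
  | |- runs_in _ (Unpair _ _) _ _ =>
      eapply runs_in_unpair; [run | run_branch]
  | |- runs_in _ (MkInl _) _ _ => eapply runs_in_inl; run
  | |- runs_in _ (MkInr _) _ _ => eapply runs_in_inr; run
  | |- runs_in _ (Case _ _ _) _ _ => eapply runs_in_case; [run | run_branch]
  | |- runs_in _ (NatConst _) _ _ => apply: runs_in_nat
  | |- runs_in _ (NatSucc _) _ _ => eapply runs_in_succ; run
  | |- runs_in _ (NatLe _ _) _ _ => eapply runs_in_natle; [run | run]
  | |- runs_in _ (RealConst _) _ _ => apply: runs_in_real
  | |- runs_in _ (RealOp _ _ _) _ _ => eapply runs_in_op; [run | run]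
  | |- runs_in _ (RealLe _ _) _ _ => eapply runs_in_le_real; [run | run]
  | |- runs_in _ (MkArray _) _ _ => eapply runs_in_array; run
  | |- runs_in _ (ArrayGet _ _) _ _ =>
      eapply runs_in_get; [run | run | eassumption]
  end
with run_branch :=
  run_reduce;
  lazymatch goal with
  | |- runs_in _ _ _ _ => run
  | |- _ => cbn; run_reduce; run
  end
with run_call :=
  match goal with
  | H : runs_in _ ?body _ _ |- runs_in _ ?body _ _ => exact: H
  end.

Ltac run_body :=
  eapply runs_in_le;
  [lazymatch goal with |- runs_in _ ?body _ _ => unfold body end; run |].

Ltac run_body_eq :=
  eapply runs_in_eq;
  [lazymatch goal with |- runs_in _ ?body _ _ => unfold body end; run | |].

(** * Encodings *)

Inductive plan :=
  | NoChoice
  | Choose (o : option nat) (p : plan)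
  | Both (p1 p2 : plan).

Lemma plan_comparable : comparable plan.
Proof.
move=> p p'; rewrite /decidable; decide equality.
exact: (@eq_comparable (option nat)).
Qed.

HB.instance Definition _ := hasDecEq.Build plan (compareP plan_comparable).

Fixpoint choices (p : plan) : seq (option nat) :=
  match p with
  | NoChoice => [::]
  | Choose o p => o :: choices p
  | Both p1 p2 => choices p1 ++ choices p2
  end.

Fixpoint plan_size (p : plan) : nat :=
  match p with
  | NoChoice => 1
  | Choose o p => (plan_size p).+1
  | Both p1 p2 => (plan_size p1 + plan_size p2).+1
  end.

Section Encodings.
Variable R : realFieldType.

Definition enc_option (o : option nat) : value R :=
  if o is Some i then VInr (VNat i) else VInl VUnit.

Fixpoint enc_plan (p : plan) : value R :=
  match p with
  | NoChoice => VInl VUnit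
  | Choose o p => VInr (VInl (VPair (enc_option o) (enc_plan p)))
  | Both p1 p2 => VInr (VInr (VPair (enc_plan p1) (enc_plan p2)))
  end.

Definition item := (R * R * plan)%type.
Definition enc_item (x : item) : value R :=
  VPair (VReal x.1.1) (VPair (VReal x.1.2) (enc_plan x.2)).
Definition enc_items (l : seq item) : value R := VList (map enc_item l).

Definition line (T : Type) := (R * R * T)%type.
Definition lev (T : Type) (l : line T) (x : R) : R := l.1.1 + l.1.2 * x.
Definition enc_line (T : Type) (enc : T -> value R) (l : line T) : value R :=
  VPair (VReal l.1.1) (VPair (VReal l.1.2) (enc l.2)).

End Encodings.

Arguments enc_option {R}.
Arguments enc_plan {R}.

(** * Lower envelopes of lines *)

Section Hull.
Variables (R : realFieldType) (T : Type) (enc : T -> value R).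
Local Notation line := (line R T).
Local Notation enc_lines := (fun h : seq line => VList (map (enc_line enc) h)).
Implicit Types (l : line) (h ls : seq line).

Fixpoint push l h : seq line :=
  match h with
  | [::] => [:: l]
  | l1 :: h' =>
      if l1.1.2 <= l.1.2 then if l1.1.1 <= l.1.1 then h else push l h'
      else match h' with
      | [::] => l :: h
      | l2 :: _ =>
          if (l.1.1 - l1.1.1) * (l2.1.2 - l1.1.2)
             <= (l1.1.1 - l2.1.1) * (l1.1.2 - l.1.2)
          then push l h' else l :: h
      end
  end.

Definition hull (ls : seq line) : seq line := foldr push [::] ls.

Fixpoint advance (x : R) h : seq line :=
  match h with
  | l1 :: h1 =>
      if h1 is l2 :: _ then
        if lev l2 x <= lev l1 x then advance x h1 else h
      else h
  | [::] => h
  end.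

Lemma push_cons l l1 h :
  push l (l1 :: h) =
  if l1.1.2 <= l.1.2 then if l1.1.1 <= l.1.1 then l1 :: h else push l h
  else if h is l2 :: _ then
    if (l.1.1 - l1.1.1) * (l2.1.2 - l1.1.2)
       <= (l1.1.1 - l2.1.1) * (l1.1.2 - l.1.2)
    then push l h else [:: l, l1 & h]
  else [:: l; l1].
Proof. by case: h. Qed.

Lemma size_push l h : (0 < size (push l h) <= (size h).+1)%N.
Proof.
elim: h => [|l1 h IHh] //; rewrite push_cons.
case: ifP => _; first by case: ifP => _ //=; lia.
by case: h IHh => //= l2 h IHh; case: ifP => _ //=; lia.
Qed.

Lemma push_runs l h :
  runs_in [:: VPair (enc_line enc l) (enc_lines h)] push_body
    (enc_lines (push l h)) (50 * (size h + 2 - size (push l h))).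
Proof.
elim: h => [|l1 h IHh]; first by case: l => [[a s] u]; run_body => //=; lia.
have hs := size_push l h; rewrite push_cons.
case: l l1 IHh hs => [[a s] u] [[a1 s1] u1] IHh hs.
case: ifP => /= es; first (case: ifP => /= ea).
- by run_body; rewrite /=; lia.
- by run_body; rewrite /=; lia.
case: h IHh hs => [|[[a2 s2] u2] h] IHh hs; first by run_body; rewrite /=; lia.
case: ifP => /= et; first by run_body; move: hs => /=; lia.
by run_body; rewrite /=; lia.
Qed.

Lemma size_hull ls : (size (hull ls) <= size ls)%N.
Proof.
elim: ls => //= l ls IHls; have /andP[_] := size_push l (hull ls).
by move/leq_trans; apply.
Qed.

Lemma hull_runs ls :
  runs_in [:: enc_lines ls] hull_body (enc_lines (hull ls))
    (200 * size ls + 10 - 50 * size (hull ls)).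
Proof.
elim: ls => [|l ls IHls]; first by run_body => //=; lia.
have IH := push_runs l (hull ls).
have le1 := size_hull ls; have le2 := size_push l (hull ls).
by run_body => /=; lia.
Qed.

Lemma size_advance x h : (size (advance x h) <= size h)%N.
Proof.
by elim: h => [|l1 [|l2 h] IHh] //=; case: ifP => // _; apply: leqW.
Qed.

Lemma advance_cons2 x l1 l2 h :
  advance x [:: l1, l2 & h] =
  if lev l2 x <= lev l1 x then advance x (l2 :: h) else [:: l1, l2 & h].
Proof. by []. Qed.

Lemma advance_runs x h :
  runs_in [:: VPair (VReal x) (enc_lines h)] advance_body
    (enc_lines (advance x h)) (50 * (size h + 1 - size (advance x h))).
Proof.
elim: h => [|l1 [|l2 h] IHh]; try by run_body => //=; lia.
rewrite advance_cons2; have hs := size_advance x (l2 :: h).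
case: l1 l2 IHh hs => [[a1 s1] u1] [[a2 s2] u2] IHh hs.
by case: ifP; rewrite /lev /= => E; run_body; move: hs => /=; lia.
Qed.

End Hull.

Section Envelope.
Variables (R : realFieldType) (T : eqType).
Local Notation line := (line R T).
Implicit Types (l : line) (h ls : seq line).

(* The inequality between products says that l2 is somewhere strictly below
   both of its neighbours. *)
Fixpoint convex h : bool :=
  match h with
  | l1 :: h1 =>
      match h1 with
      | l2 :: h2 =>
          [&& l1.1.2 < l2.1.2,
              (if h2 is l3 :: _ then
                 (l2.1.1 - l3.1.1) * (l2.1.2 - l1.1.2)
                 < (l1.1.1 - l2.1.1) * (l3.1.2 - l2.1.2)
               else true)
            & convex h1]
      | [::] => true
      end
  | [::] => true
  end.

Lemma convex_behead l h : convex (l :: h) -> convex h.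
Proof. by case: h => // l2 h /and3P[]. Qed.

Lemma convex_lev_le x l1 l2 h l :
  convex [:: l1, l2 & h] -> lev l1 x <= lev l2 x -> l \in l2 :: h ->
  lev l1 x <= lev l x.
Proof.
elim: h l1 l2 => [|l3 h IHh] l1 l2.
  by move=> _ le12; rewrite inE => /eqP->.
move=> /and3P[lt12 conv cv] le12; rewrite inE => /predU1P[->//|lh].
apply: (le_trans le12); apply: (IHh _ l3) => //.
have /and3P[lt23 _ _] := cv; rewrite leNgt; apply/negP => lt32.
suff: (l1.1.1 - l2.1.1) * (l3.1.2 - l2.1.2)
      <= (l2.1.1 - l3.1.1) * (l2.1.2 - l1.1.2) by rewrite leNgt conv.
have h1 : l1.1.1 - l2.1.1 <= (l2.1.2 - l1.1.2) * x.
  by move: le12; rewrite /lev; lra.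
have h2 : (l3.1.2 - l2.1.2) * x <= l2.1.1 - l3.1.1.
  by move: lt32; rewrite /lev; lra.
have d1 : 0 <= l2.1.2 - l1.1.2 by rewrite subr_ge0 ltW.
have d2 : 0 <= l3.1.2 - l2.1.2 by rewrite subr_ge0 ltW.
apply: (le_trans (ler_wpM2r d2 h1)).
by rewrite mulrAC [_ * (l3.1.2 - _)]mulrC mulrAC; apply: ler_wpM2r.
Qed.

Lemma convex_push l h :
  convex h -> all (fun l1 => l.1.2 <= l1.1.2) h -> convex (push l h).
Proof.
elim: h => // l1 h IHh cv /= /andP[le1 leh]; have cv' := convex_behead cv.
have IH := IHh cv' leh; case: ifP => [ge1|].
  by case: ifP.
move=> /negbT; rewrite -ltNge => lt1; case: h cv cv' IHh leh IH => [|l2 h].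
  by move=> *; rewrite /= lt1.
move=> cv cv' IHh leh IH; case: ifP => // /negbT; rewrite -ltNge => lt.
by apply/and3P; split.
Qed.

Lemma mem_push l h : {subset push l h <= l :: h}.
Proof.
elim: h => // l1 h IHh; rewrite push_cons => l'.
have sub : l' \in push l h -> l' \in [:: l, l1 & h].
  by move/IHh; rewrite !inE => /orP[->//|->]; rewrite !orbT.
case: ifP => _; first by case: ifP => _ //; rewrite !inE => ->; rewrite orbT.
by case: h {IHh} sub => // l2 h sub; case: ifP.
Qed.

Lemma mem_hull ls : {subset hull ls <= ls}.
Proof.
elim: ls => // l ls IHls l' /mem_push; rewrite !inE => /orP[->//|/IHls->].
by rewrite orbT.
Qed.

Lemma push_min x l h l0 :
  convex h -> all (fun l1 => l.1.2 <= l1.1.2) h -> l0 \in l :: h ->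
  exists2 l', l' \in push l h & lev l' x <= lev l0 x.
Proof.
elim: h l0 => [|l1 h IHh] l0 cv; first by exists l0.
move=> /= /andP[le1 leh].
have {IHh} IH l2 : l2 \in l :: h ->
    exists2 l', l' \in push l h & lev l' x <= lev l2 x.
  by move=> l2h; apply: IHh => //; apply: convex_behead cv.
have popped: (exists2 l', l' \in l :: h & lev l' x <= lev l1 x) ->
    l0 \in [:: l, l1 & h] ->
    exists2 l', l' \in push l h & lev l' x <= lev l0 x.
  move=> [l2 l2h le2]; rewrite !inE => /or3P[/eqP->|/eqP->|l0h].
  - by apply: IH; rewrite inE eqxx.
  - by have [l' l'h le'] := IH _ l2h; exists l' => //; apply: le_trans le2.
  - by apply: IH; rewrite inE l0h orbT.
case: ifP => [ge1|]; last first.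
  move=> /negbT; rewrite -ltNge => lt1.
  case: h cv leh IH popped => [|l2 h] cv leh IH popped; first by exists l0.
  case: ifP => [useless|]; last by exists l0.
  apply: popped; have /and3P[lt12 _ _] := cv.
  case: (leP (lev l x) (lev l1 x)) => [le_l|lt_l].
    by exists l; rewrite ?inE ?eqxx.
  exists l2; rewrite ?inE ?eqxx ?orbT // leNgt; apply/negP => lt_2.
  suff: (l1.1.1 - l2.1.1) * (l1.1.2 - l.1.2)
      < (l.1.1 - l1.1.1) * (l2.1.2 - l1.1.2) by rewrite ltNge useless.
  have h1 : l1.1.1 - l2.1.1 < (l2.1.2 - l1.1.2) * x.
    by move: lt_2; rewrite /lev; lra.
  have h2 : (l1.1.2 - l.1.2) * x < l.1.1 - l1.1.1.
    by move: lt_l; rewrite /lev; lra.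
  rewrite -subr_gt0 in lt1; rewrite -subr_gt0 in lt12.
  apply: (lt_trans (y := (l2.1.2 - l1.1.2) * x * (l1.1.2 - l.1.2))).
    by rewrite ltr_pM2r.
  by rewrite mulrAC [_ * (l1.1.2 - _)]mulrC mulrAC ltr_pM2r.
have eqs : l.1.2 = l1.1.2 by apply/eqP; rewrite eq_le le1.
case: ifP => [le_a|].
  rewrite inE => /predU1P[->|l0h]; last by exists l0.
  by exists l1; rewrite ?inE ?eqxx // /lev eqs lerD2r.
move=> /negbT; rewrite -ltNge => lt_a; apply: popped.
by exists l; rewrite ?inE ?eqxx // /lev eqs lerD2r ltW.
Qed.

Lemma hullP (x : R) ls :
  sorted (fun l1 l2 => l1.1.2 <= l2.1.2) ls ->
  convex (hull ls) /\
  {in ls, forall l, exists2 l', l' \in hull ls & lev l' x <= lev l x}.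
Proof.
have tr : transitive (fun l1 l2 : line => l1.1.2 <= l2.1.2).
  by move=> ? ? ?; apply: le_trans.
elim: ls => // l ls IHls srt.
have [cv cov] := IHls (path_sorted srt).
have ge_l : all (fun l1 => l.1.2 <= l1.1.2) (hull ls).
  by apply/allP => l1 /mem_hull; apply/(allP (order_path_min tr srt)).
split=> [|l0]; first exact: convex_push.
rewrite inE => /predU1P[->|/cov[l1 l1h le1]].
  by apply: push_min; rewrite ?inE ?eqxx.
have [|l' l'h le'] := push_min x cv ge_l (l0 := l1).
  by rewrite inE l1h orbT.
by exists l' => //; apply: le_trans le1.
Qed.

Lemma convex_advance x h : convex h -> convex (advance x h).
Proof.
elim: h => // l1 [|l2 h] // IHh cv; rewrite advance_cons2.
by case: ifP => // _; apply/IHh/(convex_behead cv).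
Qed.

Lemma mem_advance x h : {subset advance x h <= h}.
Proof.
elim: h => // l1 [|l2 h] IHh l //; rewrite advance_cons2; case: ifP => // _.
by move/IHh => lh; rewrite inE lh orbT.
Qed.

Lemma advance_min x h :
  convex h ->
  if advance x h is l1 :: _ then {in h, forall l, lev l1 x <= lev l x}
  else h = [::].
Proof.
elim: h => // l1 [|l2 h] IHh cv; first by move=> l; rewrite inE => /eqP->.
rewrite advance_cons2; case: ifP => [le21|].
  have := IHh (convex_behead cv); case: (advance _ _) => // l3 _ min3 l.
  rewrite inE => /predU1P[->|]; last exact: min3.
  by apply: le_trans le21; apply: min3; rewrite inE eqxx.
move=> /negbT; rewrite -ltNge => /ltW le12 l.
by rewrite inE => /predU1P[->//|]; apply: convex_lev_le.
Qed.

(* Queries come in decreasing order: a line beaten by its steeper successor at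
   x stays beaten to the left of x. *)
Lemma advance_cover x y h l :
  convex h -> y <= x -> l \in h ->
  exists2 l', l' \in advance x h & lev l' y <= lev l y.
Proof.
move=> cv le_yx; elim: h cv l => // l1 [|l2 h] IHh cv l lh; first by exists l.
rewrite advance_cons2; case: ifP => [le21|]; last by exists l.
have /and3P[lt12 _ cv'] := cv.
move: lh; rewrite inE => /predU1P[->|]; last exact: IHh.
have [|l' l'h le'] := IHh cv' l2; first by rewrite inE eqxx.
exists l' => //; apply: (le_trans le').
have : (l2.1.2 - l1.1.2) * y <= (l2.1.2 - l1.1.2) * x.
  by apply: ler_wpM2l => //; rewrite subr_ge0 ltW.
by move: le21; rewrite /lev; lra.
Qed.

End Envelope.

(** * Merge sort *)

Section Merge.
Variables (R : realFieldType) (T : Type) (enc : T -> value R) (key : T -> R).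
Hypothesis enc_keyE : forall x : T,
  exists u w, enc x = VPair u (VPair (VReal (key x)) w).
Local Notation enc_list := (fun l : seq T => VList (map enc l)).

Definition le_key (x y : T) : bool := key x <= key y.

Lemma le_key_trans : transitive le_key.
Proof. by move=> ? ? ?; apply: le_trans. Qed.

Lemma le_key_total : total le_key.
Proof. by move=> ? ?; apply: le_total. Qed.

Lemma merge_runs (l1 l2 : seq T) :
  runs_in [:: VPair (enc_list l1) (enc_list l2)] merge_body
    (enc_list (merge le_key l1 l2)) (40 * (size l1 + size l2) + 40).
Proof.
elim: l1 l2 => [|x1 l1 IH1] l2; first by run_body => //=; lia.
elim: l2 => [|x2 l2 IH2]; first by run_body => //=; lia.
have [u1 [w1 e1]] := enc_keyE x1; have [u2 [w2 e2]] := enc_keyE x2.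
have {}IH1 := IH1 (x2 :: l2).
move: IH1 IH2 => /=; rewrite /le_key e1 e2 => IH1 IH2.
by case: ifP => /= E; rewrite ?e1 ?e2; run_body => /=; lia.
Qed.

End Merge.

Section Sort.
Variables (R : realFieldType) (T : eqType) (enc : T -> value R) (key : T -> R).
Hypothesis enc_keyE : forall x : T,
  exists u w, enc x = VPair u (VPair (VReal (key x)) w).
Local Notation enc_list := (fun l : seq T => VList (map enc l)).
Local Notation le_key := (le_key key).

Lemma split_runs (l : seq T) :
  exists l1 l2, [/\ perm_eq (l1 ++ l2) l, size l1 = uphalf (size l),
    size l2 = half (size l)
  & runs_in [:: enc_list l] split_body (VPair (enc_list l1) (enc_list l2))
      (40 * size l + 40)].
Proof.
elim: l => [|x l [l1 [l2 [prm sz1 sz2 run_l]]]].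
  by exists [::], [::]; split=> //; run_body => //=; lia.
exists (x :: l2), l1; split=> /=; rewrite ?sz1 ?sz2 ?uphalfE //.
  by rewrite /= perm_cons perm_catC.
by run_body => //=; lia.
Qed.

Lemma sort_runs (k : nat) (l : seq T) : (size l <= 2 ^ k)%N ->
  exists l', [/\ perm_eq l' l, sorted le_key l'
  & runs_in [:: enc_list l] sort_body (enc_list l')
      (200 * (size l * k + size l) + 10)].
Proof.
elim: k l => [|k IHk] [|x [|y l]] //.
- by exists [::]; split=> //; run_body => //=; lia.
- by exists [:: x]; split=> //; run_body => //=; lia.
- by exists [::]; split=> //; run_body => //=; lia.
- by exists [:: x]; split=> //; run_body => //=; lia.
move=> le_l; have [l1 [l2 [prm sz1 sz2 split_l]]] := split_runs [:: x, y & l].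
have sz : (size l1 + size l2 = (size l).+2)%N.
  by rewrite -size_cat (perm_size prm).
rewrite expnS /= in le_l sz1 sz2.
have [|l1' [prm1 srt1 sort1]] := IHk l1; first by lia.
have [|l2' [prm2 srt2 sort2]] := IHk l2; first by lia.
have merge_l := merge_runs enc_keyE l1' l2'.
rewrite (perm_size prm1) (perm_size prm2) in merge_l.
exists (merge le_key l1' l2'); split.
- by rewrite perm_merge (perm_trans (perm_cat prm1 prm2)).
- exact: (merge_sorted (le_key_total _)).
run_body => //=.
have -> : ((size l).+2 = size l1 + size l2)%N by [].
by lia.
Qed.

End Sort.

Section Keys.
Variables (R : realFieldType) (b : nat) (B : 'I_b -> buffer R).

Definition enc_key (i : 'I_b) : value R :=
  VPair VUnit (VPair (VReal (buf_C (B i))) (VNat i)).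

Lemma keys_runs (s : seq 'I_b) (k : nat) : map val s = iota k (size s) ->
  runs_in [:: VPair (VList [seq encode_buffer (B i) | i <- s]) (VNat k)]
    keys_body (VList (map enc_key s)) (30 * size s + 10).
Proof.
elim: s k => [|i s IHs] k /=; first by move=> _; run_body => //=; lia.
rewrite /enc_key => -[<- /IHs {}IHs].
by run_body => //=; lia.
Qed.

End Keys.

(** * Solutions of subtrees *)

Section Solutions.
Variable R : realFieldType.
Local Notation item := (item R).
Local Notation line := (line R unit).
Implicit Types (L : seq item) (ls h : seq line) (x : item).

Lemma enc_item_key x : exists u w, enc_item x = VPair u (VPair (VReal x.1.2) w).
Proof. by do 2!eexists. Qed.

Definition enc_uline : line -> value R := enc_line (fun=> VUnit).

(* The solution of a subtree without buffer positions is a single pair (q, c).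
   Otherwise it is the list [map (shift ls s d c) L]: an edge, or a branch
   without buffer positions, changes (ls, s, d, c) in constant time and leaves
   L alone.  A branch of slack q0 caps the slacks at q0, which in terms of the
   capacitances of L means a cap by a line. *)
Inductive sol :=
  | Single (q c : R)
  | Multi (L : seq item) (ls : seq line) (s d c : R).

Definition lmin (q : R) ls (y : R) : R :=
  foldr (fun l m => Num.min (lev l y) m) q ls.

Definition shift ls (s d c : R) x : item :=
  (lmin x.1.1 ls (- x.1.2) + s * x.1.2 - d, x.1.2 + c, x.2).

Definition items (z : sol) : seq item :=
  match z with
  | Single q c => [:: (q, c, NoChoice)]
  | Multi L ls s d c => map (shift ls s d c) L
  end.

Definition enc_weights (s d c : R) : value R :=
  VPair (VReal s) (VPair (VReal d) (VReal c)).

Definition enc_sol (z : sol) : value R :=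
  match z with
  | Single q c => VInl (VPair (VReal q) (VReal c))
  | Multi L ls s d c =>
      VInr (VPair (enc_items L)
        (VPair (VList (map enc_uline ls)) (enc_weights s d c)))
  end.

Definition size_items (z : sol) : nat :=
  if z is Multi L _ _ _ _ then size L else 1.

Definition size_lines (z : sol) : nat :=
  if z is Multi _ ls _ _ _ then size ls else 0.

Definition wf_sol (z : sol) : bool :=
  if z is Multi L ls s d c then
    sorted (le_key (fun x => x.1.2)) L
    && path (fun s1 s2 => s1 <= s2) s (map (fun l => l.1.2) ls)
  else true.

Lemma lmin_eq (m q : R) ls (y : R) :
  m <= q -> {in ls, forall l, m <= lev l y} ->
  m = q \/ (exists2 l, l \in ls & m = lev l y) -> m = lmin q ls y.
Proof.
move=> le_q le_ls eq_m; apply/eqP; rewrite eq_le; apply/andP; split.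
  by elim: ls le_ls {eq_m} => //= l ls IHls le_ls; rewrite le_min le_ls
    ?inE ?eqxx // IHls // => l' l'ls; rewrite le_ls // inE l'ls orbT.
case: eq_m => [->|[l + ->]].
  by elim: ls {le_ls} => //= l ls IHls; rewrite ge_min IHls orbT.
elim: ls {le_ls} => //= l' ls IHls; rewrite inE ge_min.
by case/predU1P=> [<-|/IHls->]; rewrite ?lexx ?orbT.
Qed.

Lemma cut_runs ls s d c L h :
  convex h -> {subset h <= ls} ->
  {in L & ls, forall x l, exists2 l', l' \in h &
    lev l' (- x.1.2) <= lev l (- x.1.2)} ->
  sorted (le_key (fun x => x.1.2)) L ->
  runs_in [:: VPair (enc_items L)
                (VPair (VList (map enc_uline h)) (enc_weights s d c))] cut_body
    (enc_items (map (shift ls s d c) L)) (200 * size L + 50 * size h + 10).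
Proof.
elim: L h => [|[[q cx] p] L IHL] h cv sub cov srt.
  by run_body => //=; lia.
have adv := advance_runs (fun=> VUnit) (0%:R - cx) h.
have le_h := size_advance (0%:R - cx) h.
have min_h := advance_min (0%:R - cx) cv.
have sub1 := @mem_advance _ _ (0%:R - cx) h.
have cov1 : {in L & ls, forall x l,
    exists2 l', l' \in advance (0%:R - cx) h
              & lev l' (- x.1.2) <= lev l (- x.1.2)}.
  move=> x l xL lls; have [|l1 l1h le1] := cov x l _ lls.
    by rewrite inE xL orbT.
  have le_x : cx <= x.1.2.
    by apply: (allP (order_path_min (@le_key_trans _ _ _) srt)).
  have [|l' l'h le'] := advance_cover (y := - x.1.2) cv _ l1h (x := 0%:R - cx).
    by rewrite sub0r lerN2.
  by exists l' => //; apply: le_trans le1.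
have run_L := IHL _ (convex_advance _ cv)
  (fun l lh => sub _ (sub1 _ lh)) cov1 (path_sorted srt).
have cov_q l : l \in ls ->
    exists2 l', l' \in h & lev l' (0%:R - cx) <= lev l (0%:R - cx).
  move=> lls; rewrite sub0r; apply: (cov (q, cx, p)) => //.
  by rewrite inE eqxx.
clear IHL cov cov1 srt; rewrite -/enc_uline in adv.
case: (advance _ h) adv le_h min_h sub1 run_L => [|l1 h1] /=.
  move=> adv _ h0 _ run_L; run_body_eq => //; last by rewrite /=; lia.
  rewrite /= /enc_item /= /shift /=.
  case: ls {sub run_L} cov_q => //= l ls cov_q.
  by have [|l' l'h] := cov_q l; [rewrite inE eqxx | rewrite h0 in l'h].
move=> adv le_h min_h sub1 run_L.
pose m := if q <= lev l1 (0%:R - cx) then q else lev l1 (0%:R - cx).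
have eq_m : m = lmin q ls (- cx).
  have h1h : l1 \in h by apply: sub1; rewrite inE eqxx.
  rewrite /m -[X in lmin _ _ X]sub0r; apply: lmin_eq.
  - by case: ifP => // /negbT; rewrite -ltNge => /ltW.
  - move=> l /cov_q[l' /min_h le1 le2].
    by apply: le_trans le2; apply: le_trans le1; case: ifP.
  - case: ifP => _; first by left.
    by right; exists l1 => //; apply: sub.
rewrite /= {1}/shift /= -eq_m /m.
case: l1 {min_h sub1 eq_m m} adv run_L => [[a1 s1] u1] adv run_L.
by case: ifP; rewrite /lev /= => E; run_body_eq => //=; lia.
Qed.

Lemma force_runs z : wf_sol z ->
  runs_in [:: enc_sol z] force_body (enc_items (items z))
    (200 * size_items z + 300 * size_lines z + 60).
Proof.
case: z => [q c|L ls s d c] /=; first by move=> _; run_body => //=; lia.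
case/andP=> srtL srt_ls.
have srt : sorted (fun l1 l2 : line => l1.1.2 <= l2.1.2) ls.
  by move: (path_sorted srt_ls); rewrite sorted_map.
have hull_ls := hull_runs (fun=> VUnit) ls.
have le_h := size_hull ls.
have [cv _] := hullP 0 srt.
have cov : {in L & ls, forall x l, exists2 l', l' \in hull ls &
    lev l' (- x.1.2) <= lev l (- x.1.2)}.
  by move=> x l _ lls; have [_ cov] := hullP (- x.1.2) srt; apply: cov.
have run_L := cut_runs (h := hull ls) s d c cv (@mem_hull _ _ ls) cov srtL.
rewrite -/enc_uline in hull_ls.
by run_body => /=; lia.
Qed.

End Solutions.

Section Operations.
Variable R : realFieldType.
Local Notation item := (item R).
Local Notation sol := (sol R).
Local Notation le_cap := (le_key (fun x : item => x.1.2)).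
Implicit Types (L : seq item) (x : item) (z : sol) (e : edge R).

Lemma sorted_items z : wf_sol z -> sorted le_cap (items z).
Proof.
case: z => //= L ls s d c /andP[srt _]; rewrite sorted_map.
by apply: sub_sorted srt => x y; rewrite /le_key /= lerD2r.
Qed.

Lemma size_itemsE z : size (items z) = size_items z.
Proof. by case: z => //= L *; rewrite size_map. Qed.

Lemma shift_nil x : shift [::] 0 0 0 x = x.
Proof. by case: x => [[q c] p]; rewrite /shift /= mul0r !addr0 subr0. Qed.

Definition delay_item e x : item :=
  (x.1.1 - edge_delay e x.1.2, edge_C e + x.1.2, x.2).

Definition wire e z : sol :=
  match z with
  | Single q c => Single (q - edge_delay e c) (edge_C e + c)
  | Multi L ls s d c =>
      Multi L ls (s - edge_R e) (d + edge_delay e c) (edge_C e + c)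
  end.

Lemma items_wire e z : items (wire e z) = map (delay_item e) (items z).
Proof.
case: z => //= L ls s d c; rewrite -map_comp; apply: eq_map => x.
by congr (_, _, _); rewrite /= /edge_delay; ring.
Qed.

Lemma wf_wire e z : 0 <= edge_R e -> wf_sol z -> wf_sol (wire e z).
Proof.
case: z => //= L ls s d c e_ge0 /andP[-> /=].
by case: ls => //= l ls /andP[le_s ->]; rewrite andbT; lra.
Qed.

Lemma edge_runs e z :
  runs_in [:: VPair (encode_edge e) (enc_sol z)] edge_body (enc_sol (wire e z))
    60.
Proof. by case: e z => re ce [q c|L ls s d c]; run_body_eq. Qed.

Fixpoint join L1 : seq item -> seq item :=
  match L1 with
  | [::] => fun=> [::]
  | x1 :: L1' =>
      fix join_x1 L2 :=
        match L2 with
        | [::] => [::]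
        | x2 :: L2' =>
            let c := x1.1.2 + x2.1.2 in
            let p := Both x1.2 x2.2 in
            if x1.1.1 <= x2.1.1 then (x1.1.1, c, p) :: join L1' L2
            else (x2.1.1, c, p) :: join_x1 L2'
        end
  end.

Lemma join_cons x1 L1 x2 L2 :
  join (x1 :: L1) (x2 :: L2) =
  (Num.min x1.1.1 x2.1.1, x1.1.2 + x2.1.2, Both x1.2 x2.2)
  :: if x1.1.1 <= x2.1.1 then join L1 (x2 :: L2) else join (x1 :: L1) L2.
Proof. by rewrite /=; case: leP. Qed.

Lemma join_runs L1 L2 :
  runs_in [:: VPair (enc_items L1) (enc_items L2)] join_body
    (enc_items (join L1 L2)) (60 * (size L1 + size L2) + 10).
Proof.
elim: L1 L2 => [|x1 L1 IH1] L2; first by run_body => //=; lia.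
elim: L2 => [|x2 L2 IH2]; first by run_body => //=; lia.
have {}IH1 := IH1 (x2 :: L2).
case: x1 x2 IH1 IH2 => [[q1 c1] p1] [[q2 c2] p2] IH1 IH2; rewrite join_cons.
by rewrite minEle /=; case: ifP => E; run_body_eq => //=; lia.
Qed.

Lemma size_join L1 L2 : (size (join L1 L2) <= (size L1 + size L2).-1)%N.
Proof.
elim: L1 L2 => // x1 L1 IH1; elim=> [|x2 L2 IH2] //.
rewrite join_cons; case: ifP => _; first by have /= := IH1 (x2 :: L2); lia.
by move: IH2 => /=; lia.
Qed.

Lemma size_join_gt0 L1 L2 :
  (0 < size L1)%N -> (0 < size L2)%N -> (0 < size (join L1 L2))%N.
Proof. by case: L1 L2 => [|x1 L1] [|x2 L2] // _ _; rewrite join_cons. Qed.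

Lemma mem_join L1 L2 x : x \in join L1 L2 ->
  exists x1 x2, [/\ x1 \in L1, x2 \in L2 &
    x = (Num.min x1.1.1 x2.1.1, x1.1.2 + x2.1.2, Both x1.2 x2.2)].
Proof.
elim: L1 L2 => // x1 L1 IH1; elim=> [|x2 L2 IH2] //.
rewrite join_cons inE => /predU1P[->|].
  by exists x1, x2; rewrite !inE !eqxx.
case: ifP => _; first move=> /IH1; last move=> /IH2.
  move=> [y1 [y2 [y1L y2L ->]]]; exists y1, y2; split=> //.
  by rewrite inE y1L orbT.
move=> [y1 [y2 [y1L y2L ->]]]; exists y1, y2; split=> //.
by rewrite inE y2L orbT.
Qed.

Lemma sorted_join L1 L2 :
  sorted le_cap L1 -> sorted le_cap L2 -> sorted le_cap (join L1 L2).
Proof.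
have tr := @le_key_trans _ _ (fun x : item => x.1.2).
elim: L1 L2 => // x1 L1 IH1; elim=> [|x2 L2 IH2] // srt1 srt2.
have /allP min1 := order_path_min tr srt1.
have /allP min2 := order_path_min tr srt2.
rewrite join_cons /sorted path_sortedE //; apply/andP; split; last first.
  by case: ifP => _; [apply: IH1 (path_sorted srt1) _
                     | apply: IH2 (path_sorted srt2)].
apply/allP => y; case: ifP => _ yJ; have [y1 [y2 [y1L y2L ->]]] := mem_join yJ.
  rewrite /le_key /= lerD //; first exact: min1.
  by move: y2L; rewrite inE => /predU1P[->//|]; apply: min2.
rewrite /le_key /= lerD //; last exact: min2.
by move: y1L; rewrite inE => /predU1P[->//|]; apply: min1.
Qed.

Lemma join_complete L1 L2 y1 y2 :
  sorted le_cap L1 -> sorted le_cap L2 -> y1 \in L1 -> y2 \in L2 ->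
  exists2 x, x \in join L1 L2 &
    Num.min y1.1.1 y2.1.1 <= x.1.1 /\ x.1.2 <= y1.1.2 + y2.1.2.
Proof.
have tr := @le_key_trans _ _ (fun x : item => x.1.2).
elim: L1 L2 => // x1 L1 IH1; elim=> [|x2 L2 IH2] // srt1 srt2 y1L y2L.
have le1 : x1.1.2 <= y1.1.2.
  move: y1L; rewrite inE => /predU1P[->//|].
  exact: (allP (order_path_min tr srt1)).
have le2 : x2.1.2 <= y2.1.2.
  move: y2L; rewrite inE => /predU1P[->//|].
  exact: (allP (order_path_min tr srt2)).
rewrite join_cons; case: leP => [le_q|/ltW le_q].
  move: y1L; rewrite inE => /predU1P[->|y1L].
    exists (x1.1.1, x1.1.2 + x2.1.2, Both x1.2 x2.2); rewrite ?inE ?eqxx //=.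
    by rewrite ge_min lexx lerD2l.
  have [x xL le_x] := IH1 _ (path_sorted srt1) srt2 y1L y2L.
  by exists x; rewrite // inE xL orbT.
move: y2L; rewrite inE => /predU1P[->|y2L].
  exists (x2.1.1, x1.1.2 + x2.1.2, Both x1.2 x2.2); rewrite ?inE ?eqxx //=.
  by rewrite ge_min lexx orbT lerD2r.
have [x xL le_x] := IH2 srt1 (path_sorted srt2) y1L y2L.
by exists x; rewrite // inE xL orbT.
Qed.

Definition cap (q0 c0 : R) z : sol :=
  match z with
  | Single q c => Single (Num.min q0 q) (c0 + c)
  | Multi L ls s d c => Multi L ((q0 + d, s, tt) :: ls) s d (c + c0)
  end.

Definition union z1 z2 : sol :=
  match z1, z2 with
  | Single q c, _ => cap q c z2
  | _, Single q c => cap q c z1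
  | _, _ => Multi (join (items z1) (items z2)) [::] 0 0 0
  end.

Lemma wf_cap q0 c0 z : wf_sol z -> wf_sol (cap q0 c0 z).
Proof. by case: z => //= L ls s d c; rewrite lexx. Qed.

Lemma wf_union z1 z2 : wf_sol z1 -> wf_sol z2 -> wf_sol (union z1 z2).
Proof.
case: z1 z2 => [q1 c1|L1 ls1 s1 d1 c1] [q2 c2|L2 ls2 s2 d2 c2] wf1 wf2;
  try exact: (@wf_cap _ _ (Multi _ _ _ _ _)); first by [].
by have := sorted_join (sorted_items wf1) (sorted_items wf2); rewrite /= => ->.
Qed.

Lemma union_runs z1 z2 : wf_sol z1 -> wf_sol z2 ->
  runs_in [:: VPair (enc_sol z1) (enc_sol z2)] union_body
    (enc_sol (union z1 z2))
    (if union z1 z2 is Multi _ [::] _ _ _ then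
       260 * (size_items z1 + size_items z2)
       + 300 * (size_lines z1 + size_lines z2) + 200
     else 60).
Proof.
case: z1 z2 => [q1 c1|L1 ls1 s1 d1 c1] [q2 c2|L2 ls2 s2 d2 c2] wf1 wf2.
- by rewrite /= minEle; case: ifP => E; run_body_eq.
- by run_body_eq => //=; lia.
- by run_body_eq => //=; lia.
have run1 := force_runs wf1; have run2 := force_runs wf2.
set i1 := items _ in run1; set i2 := items _ in run2.
have run_join := join_runs i1 i2.
have sz1 : size i1 = size L1 by apply: size_map.
have sz2 : size i2 = size L2 by apply: size_map.
rewrite sz1 sz2 in run_join; move: run1 run2 => /= run1 run2.
rewrite /union -/i1 -/i2.
by run_body_eq => //=; lia.
Qed.

Lemma items_cap q0 c0 L ls s d c :
  items (cap q0 c0 (Multi L ls s d c)) =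
  [seq (Num.min q0 x.1.1, x.1.2 + c0, x.2) | x <- items (Multi L ls s d c)].
Proof.
rewrite /= -map_comp; apply: eq_map => x; rewrite /= {1}/shift /=.
congr (_, _, _); last by ring.
set m := lmin _ _ _; set y := x.1.2; rewrite -addrA addr_minl /lev /=.
by congr Num.min; ring.
Qed.

Definition union_of L1 L2 L : Prop :=
  (forall x, x \in L -> exists x1 x2, [/\ x1 \in L1, x2 \in L2
    & [/\ x.1.1 = Num.min x1.1.1 x2.1.1, x.1.2 = x1.1.2 + x2.1.2
        & choices x.2 = choices x1.2 ++ choices x2.2]])
  /\ {in L1 & L2, forall x1 x2, exists2 x, x \in L
     & Num.min x1.1.1 x2.1.1 <= x.1.1 /\ x.1.2 <= x1.1.2 + x2.1.2}.

Lemma union_of_items z1 z2 : wf_sol z1 -> wf_sol z2 ->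
  union_of (items z1) (items z2) (items (union z1 z2)).
Proof.
case: z1 z2 => [q1 c1|L1 ls1 s1 d1 c1] [q2 c2|L2 ls2 s2 d2 c2] wf1 wf2.
- split=> [x|x1 x2]; rewrite !inE.
    move=> /eqP->; exists (q1, c1, NoChoice), (q2, c2, NoChoice).
    by rewrite !inE !eqxx.
  move=> /eqP-> /eqP->.
  by exists (Num.min q1 q2, c1 + c2, NoChoice); rewrite ?inE.
- rewrite /union items_cap; set L := items (Multi L2 _ _ _ _); clearbody L.
  split=> [_ /mapP[x xL ->]|x1 x].
    exists (q1, c1, NoChoice), x; rewrite inE eqxx; split=> //.
    by split=> //=; rewrite addrC.
  rewrite inE => /eqP-> xL; exists (Num.min q1 x.1.1, x.1.2 + c1, x.2).
    by apply/mapP; exists x.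
  by rewrite /= addrC.
- rewrite /union items_cap; set L := items (Multi L1 _ _ _ _); clearbody L.
  split=> [_ /mapP[x xL ->]|x x2 xL].
    exists x, (q2, c2, NoChoice); rewrite inE eqxx; split=> //.
    by split=> //=; rewrite 1?minC ?cats0.
  rewrite inE => /eqP->; exists (Num.min q2 x.1.1, x.1.2 + c2, x.2).
    by apply/mapP; exists x.
  by rewrite /= minC.
have srt1 := sorted_items wf1; have srt2 := sorted_items wf2.
rewrite /union /=; set i1 := map _ L1 in srt1 *; set i2 := map _ L2 in srt2 *.
rewrite (eq_map shift_nil) map_id; split=> [x /mem_join|x1 x2 x1L x2L].
  by move=> [x1 [x2 [x1L x2L ->]]]; exists x1, x2.
exact: join_complete.
Qed.

End Operations.

(** * Buffer insertion at one vertex *)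

Section Position.
Variables (R : realFieldType) (b : nat) (B : 'I_b -> buffer R).
Local Notation item := (item R).
Local Notation pline := (line R plan).
Local Notation le_cap := (le_key (fun x : item => x.1.2)).
Implicit Types (L N : seq item) (x y : item) (f : {set 'I_b}).

Definition enc_pline : pline -> value R := enc_line enc_plan.
Definition enc_oitem (o : option item) : value R :=
  if o is Some x then VInr (enc_item x) else VInl VUnit.

Definition item_line x : pline := (0%:R - x.1.1, x.1.2, x.2).
Definition unbuffered x : item := (x.1.1, x.1.2, Choose None x.2).

Lemma lines_runs L :
  runs_in [:: enc_items L] lines_body
    (VList (map enc_pline (map item_line L))) (40 * size L + 10).
Proof.
elim: L => [|[[q c] p] L IHL]; first by run_body => //=; lia.
by run_body_eq => //=; lia.
Qed.

Lemma unbuffered_runs L :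
  runs_in [:: enc_items L] unbuffered_body (enc_items (map unbuffered L))
    (40 * size L + 10).
Proof.
elim: L => [|[[q c] p] L IHL]; first by run_body => //=; lia.
by run_body_eq => //=; lia.
Qed.

Definition buffered_line (j : 'I_b) (l : pline) : item :=
  (0%:R - lev l (buf_R (B j)) - buf_K (B j), buf_C (B j),
   Choose (Some (val j)) l.2).

Definition best_line (ls : seq pline) (j : 'I_b) (o : option item) : Prop :=
  exists2 l, l \in ls /\ o = Some (buffered_line j l)
    & {in ls, forall l', lev l (buf_R (B j)) <= lev l' (buf_R (B j))}.

Lemma buffered_runs (ls h : seq pline) f (s : seq 'I_b) (i : nat) :
  map val s = iota i (size s) ->
  pairwise (fun j1 j2 => buf_R (B j2) <= buf_R (B j1)) s ->
  (0 < size ls)%N -> convex h -> {subset h <= ls} ->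
  {in s & ls, forall j l, exists2 l', l' \in h &
    lev l' (buf_R (B j)) <= lev l (buf_R (B j))} ->
  exists2 g : 'I_b -> option item,
    {in s, forall j, if j \in f then best_line ls j (g j) else g j = None} &
    runs_in
      [:: VPair (VList [seq encode_buffer (B j) | j <- s])
           (VPair (VList [seq VNat (val j) | j <- s & j \in f])
           (VPair (VNat i) (VList (map enc_pline h))))] buffered_body
      (VList [seq enc_oitem (g j) | j <- s]) (200 * size s + 50 * size h + 20).
Proof.
move=> + + ls_gt0; elim: s i h => [|j s IHs] i h /=.
  by exists (fun=> None) => //; run_body_eq => //=; lia.
move=> [eq_i eq_s] /andP[/allP geR srt] cv sub cov.
have cov_s : {in s & ls, forall j l, exists2 l', l' \in h &
    lev l' (buf_R (B j)) <= lev l (buf_R (B j))}.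
  by move=> k l ks; apply: cov; rewrite inE ks orbT.
have j_s : j \notin s.
  by apply/negP => /(map_f val); rewrite eq_s mem_iota /=; lia.
have upd (o : option item) (g : 'I_b -> option item) :
    (if j \in f then best_line ls j o else o = None) ->
    {in s, forall k, if k \in f then best_line ls k (g k) else g k = None} ->
    {in j :: s, forall k, if k \in f
       then best_line ls k (if k == j then o else g k)
       else (if k == j then o else g k) = None}.
  move=> oP gP k; rewrite inE; case: eqVneq => [-> _|_ /=]; first exact: oP.
  exact: gP.
have updE (o : option item) (g : 'I_b -> option item) :
    [seq enc_oitem (if k == j then o else g k) | k <- s]
    = [seq enc_oitem (g k) | k <- s].
  apply/eq_in_map => k ks; case: eqVneq => // kj.
  by rewrite kj (negPf j_s) in ks.
case: ifPn => jf.
  have adv := advance_runs enc_plan (buf_R (B j)) h.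
  have le_h := size_advance (buf_R (B j)) h.
  have min_h := advance_min (buf_R (B j)) cv.
  have sub1 := @mem_advance _ _ (buf_R (B j)) h.
  have cov1 : {in s & ls, forall k l,
      exists2 l', l' \in advance (buf_R (B j)) h &
        lev l' (buf_R (B k)) <= lev l (buf_R (B k))}.
    move=> k l ks lls; have [l1 l1h le1] := cov_s k l ks lls.
    have [l2 l2h le2] := advance_cover cv (geR _ ks) l1h.
    by exists l2 => //; apply: le_trans le1.
  have [g gP run_g] := IHs i.+1 _ eq_s srt (convex_advance _ cv)
    (fun l lh => sub _ (sub1 _ lh)) cov1.
  have cov_j l : l \in ls -> exists2 l', l' \in h &
      lev l' (buf_R (B j)) <= lev l (buf_R (B j)).
    by apply: cov; rewrite inE eqxx.
  rewrite -/enc_pline in adv.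
  case: (advance _ h) adv le_h min_h sub1 run_g {cov1} => [|l h1] /=.
    move=> _ _ h0; case: ls ls_gt0 cov_j {IHs sub cov cov_s upd gP} => //.
    move=> l ls _ cov_j; have [|l'] := cov_j l; first by rewrite inE eqxx.
    by rewrite h0.
  move=> adv le_h min_h sub1 run_g.
  have lh : l \in h by apply: sub1; rewrite inE eqxx.
  exists (fun k => if k == j then Some (buffered_line j l) else g k).
    apply: upd => //; rewrite jf; exists l; first by split=> //; apply: sub.
    by move=> l1 /cov_j[l2 /min_h le1 le2]; apply: le_trans le2.
  rewrite eqxx updE -eq_i in run_g *.
  have le_jj : (val j <= val j)%N = true by apply: leqnn.
  case: l {lh min_h sub1} adv run_g => [[a1 s1] p1] adv run_g.
  rewrite /enc_oitem /buffered_line /lev.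
  case: (B j) adv => Kj Rj Cj /= adv.
  by run_body_eq => //=; lia.
have [g gP run_g] := IHs i.+1 h eq_s srt cv sub cov_s.
exists (fun k => if k == j then None else g k).
  by apply: upd => //; rewrite (negPf jf).
rewrite eqxx updE.
case fs: [seq k <- s | k \in f] run_g => [|k s'] run_g.
  by run_body_eq => //=; lia.
have le_ki : (val k <= i)%N = false.
  have : val k \in map val s.
    have: k \in [seq k <- s | k \in f] by rewrite fs inE eqxx.
    by rewrite mem_filter => /andP[_]; apply: map_f.
  by rewrite eq_s mem_iota; lia.
by run_body_eq => //=; lia.
Qed.

Lemma collect_runs (g : 'I_b -> option item) (s : seq 'I_b) :
  runs_in [:: VPair (VList (map (enc_key B) s))
                (VArray [seq enc_oitem (g j) | j <- enum 'I_b])] collect_body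
    (enc_items (pmap g s)) (60 * size s + 10).
Proof.
elim: s => [|j s IHs]; first by run_body_eq => //=; lia.
have gj : onth [seq enc_oitem (g j) | j <- enum 'I_b] (val j)
          = Some (enc_oitem (g j)).
  rewrite onthE -map_comp (nth_map j); first by rewrite /= nth_ord_enum.
  by rewrite size_enum_ord; apply: ltn_ord.
rewrite /=; case E: (g j) gj => [x|] gj /=; run_body_eq => //=; lia.
Qed.

Definition buffer_item (j : 'I_b) x : item :=
  (x.1.1 - (buf_R (B j) * x.1.2 + buf_K (B j)), buf_C (B j),
   Choose (Some (val j)) x.2).

Definition insertion_of f L N : Prop :=
  (forall x, x \in N -> exists2 y, y \in L &
     x = unbuffered y \/ exists2 j, j \in f & x = buffer_item j y)
  /\ (forall y, y \in L -> unbuffered y \in N)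
  /\ (forall y j, y \in L -> j \in f -> exists2 x, x \in N
        & (buffer_item j y).1.1 <= x.1.1 /\ x.1.2 = buf_C (B j)).

Definition library_order (order : seq 'I_b) : Prop :=
  perm_eq order (enum 'I_b) /\ sorted (le_key (fun j => buf_C (B j))) order.

Definition enc_context (order : seq 'I_b) : value R :=
  VPair (encode_library B) (VList (map (enc_key B) order)).

Lemma sorted_pmap_item (g : 'I_b -> option item) (s : seq 'I_b) :
  (forall j x, g j = Some x -> x.1.2 = buf_C (B j)) ->
  sorted (le_key (fun j => buf_C (B j))) s -> sorted le_cap (pmap g s).
Proof.
move=> gE; rewrite !(sorted_pairwise (@le_key_trans _ _ _)).
elim: s => //= j s IHs /andP[/allP le_j /IHs srt]; case E: (g j) => [x|] //=.
rewrite srt andbT; apply/allP => y; rewrite mem_pmap => /mapP[k ks /esym gk].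
by rewrite /le_key (gE _ _ E) (gE _ _ gk); apply: le_j.
Qed.

Lemma lev_item_line j x :
  lev (item_line x) (buf_R (B j)) = buf_R (B j) * x.1.2 - x.1.1.
Proof. by rewrite /lev /=; ring. Qed.

Lemma position_runs f (z : sol R) (order : seq 'I_b) :
  sorted_library B -> library_order order -> wf_sol z ->
  (0 < size_items z)%N ->
  exists N, [/\ insertion_of f (items z) N, sorted le_cap N,
    (size_items z <= size N <= size_items z + b)%N
  & runs_in [:: VPair (enc_context order) (VPair (encode_set R f) (enc_sol z))]
      position_body (enc_sol (Multi N [::] 0 0 0))
      (1000 * (size_items z + size_lines z + b) + 1000)].
Proof.
move=> srtB [perm_o srt_o] wfz z_gt0.
have force_z := force_runs wfz; have srtL := sorted_items wfz.
move: z_gt0 force_z; rewrite -!size_itemsE; set L := items z in srtL * => L_gt0.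
move=> force_z; clearbody L.
have lines_L := lines_runs L; set ls := map item_line L in lines_L.
have sz_ls : size ls = size L by apply: size_map.
have srt_ls : sorted (fun l1 l2 : pline => l1.1.2 <= l2.1.2) ls.
  by rewrite /ls sorted_map.
have hull_ls := hull_runs enc_plan ls; rewrite -/enc_pline in hull_ls.
have le_h : (size (hull ls) <= size ls)%N := size_hull ls.
have srtR : pairwise (fun j1 j2 => buf_R (B j2) <= buf_R (B j1)) (enum 'I_b).
  have : sorted leq (map val (enum 'I_b)) by rewrite val_enum_ord iota_sorted.
  rewrite sorted_map sorted_pairwise; last by move=> ? ? ?; apply: leq_trans.
  by apply: sub_pairwise => j1 j2; apply: srtB.
have [cv _] := hullP 0 srt_ls.
have [|||g gP run_g] :=
  buffered_runs (h := hull ls) (s := enum 'I_b) (i := 0%N) f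
    _ srtR _ cv (@mem_hull _ _ ls).
- by rewrite val_enum_ord size_enum_ord.
- by rewrite sz_ls.
- by move=> j l _ lls; have [_ cov] := hullP (buf_R (B j)) srt_ls; apply: cov.
have {}gP j : if j \in f then best_line ls j (g j) else g j = None.
  by apply: gP; rewrite mem_enum.
have fE : enum f = [seq j <- enum 'I_b | j \in f] by rewrite !enumT.
have collect_g := collect_runs g order.
have unbuf_L := unbuffered_runs L.
have sz_o : size order = b by rewrite (perm_size perm_o) size_enum_ord.
have sz_g : (size (pmap g order) <= b)%N.
  by rewrite size_pmap -[X in (_ <= X)%N]sz_o count_size.
have mem_g x : x \in pmap g order = (Some x \in map g (enum 'I_b)).
  by rewrite mem_pmap (perm_mem (perm_map g perm_o)).
have gE j x : g j = Some x -> j \in f /\ exists2 l, l \in ls /\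
    x = buffered_line j l &
    {in ls, forall l', lev l (buf_R (B j)) <= lev l' (buf_R (B j))}.
  move=> gj; have := gP j; rewrite gj; case: ifP => // _ [l [lls [->]] min_l].
  by split=> //; exists l.
have srt_g : sorted le_cap (pmap g order).
  by apply: sorted_pmap_item srt_o => j x /gE[_ [l [_ ->]]].
have merge_N := merge_runs (@enc_item_key R) (map unbuffered L) (pmap g order).
rewrite size_map in merge_N.
set N := merge _ _ _ in merge_N; exists N.
have mem_N x : (x \in N) = (x \in map unbuffered L) || (x \in pmap g order).
  by rewrite mem_merge mem_cat.
split.
- split=> [x|]; last split=> [y yL|y j yL jf].
  + rewrite mem_N mem_g => /orP[/mapP[y yL ->]|/mapP[j _ /esym]].
      by exists y; [|left].
    move=> /gE[jf [l [/mapP[y yL ->] ->] _]]; exists y => //; right.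
    exists j => //; rewrite /buffered_line lev_item_line.
    by congr (_, _, _); ring.
  + by rewrite mem_N map_f.
  have := gP j; rewrite jf => -[l [lls gj] min_l].
  exists (buffered_line j l).
    by rewrite mem_N mem_g -gj map_f ?orbT // mem_enum.
  split=> //=; have := min_l _ (map_f item_line yL).
  by rewrite lev_item_line; lra.
- apply: merge_sorted => //; first exact: le_key_total.
  by rewrite sorted_map.
- by rewrite size_merge size_cat size_map; lia.
rewrite /enc_context /encode_library /encode_set fE.
have sz_b : size [seq enc_oitem (g j) | j <- enum 'I_b] = b.
  by rewrite size_map size_enum_ord.
rewrite size_enum_ord in run_g; rewrite sz_o in collect_g.
run_body_eq => //; rewrite sz_b.
by lia.
Qed.

End Position.

(** * Slack and candidates *)

Scheme tree_mut := Induction for tree Sort Prop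
  with forest_mut := Induction for forest Sort Prop.
Combined Scheme tree_forest_ind from tree_mut, forest_mut.

Section Slack.
Variables (R : realFieldType) (b : nat) (B : 'I_b -> buffer R).
Implicit Types (t : tree R b) (ws : forest R b) (f : {set 'I_b}).

Fixpoint tree_slack t : tree_cand t -> R :=
  match t return tree_cand t -> R with
  | Sink _ rat => fun=> rat
  | Internal f ws => fun a =>
      forest_slack a.2 - vertex_delay B a.1 (load B a.2)
  end
with forest_slack ws : cand ws -> R :=
  match ws return cand ws -> R with
  | Last e t => fun a => tree_slack a - edge_delay e (down_cap B a)
  | More e t ws' => fun a =>
      Num.min (tree_slack a.1 - edge_delay e (down_cap B a.1))
              (forest_slack a.2)
  end.

Definition is_min (m : R) (s : seq R) : Prop :=
  m \in s /\ {in s, forall x, m <= x}.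

Lemma is_min_uniq (m1 m2 : R) s : is_min m1 s -> is_min m2 s -> m1 = m2.
Proof.
by move=> [m1s le1] [m2s le2]; apply/eqP; rewrite eq_le le1 ?le2.
Qed.

Lemma is_min_cat (m1 m2 : R) s1 s2 :
  is_min m1 s1 -> is_min m2 s2 -> is_min (Num.min m1 m2) (s1 ++ s2).
Proof.
move=> [m1s le1] [m2s le2]; split.
  by rewrite mem_cat; case: leP; rewrite ?m1s ?m2s ?orbT.
by move=> x; rewrite mem_cat ge_min => /orP[/le1->|/le2->]; rewrite ?orbT.
Qed.

Lemma is_min_sub (m d : R) s :
  is_min m s -> is_min (m - d) [seq x - d | x <- s].
Proof.
move=> [ms le_m]; split; first exact: (map_f (fun x => x - d)).
by move=> _ /mapP[x xs ->]; rewrite lerD2r le_m.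
Qed.

Lemma seq_min_is_min (s : seq R) : s != [::] -> is_min (seq_min s) s.
Proof.
have bigP (x0 : R) : is_min (\big[Num.min/x0]_(x <- s) x) (x0 :: s).
  elim: s => [|x s [IHin IHle]].
    by rewrite big_nil; split=> [|x]; rewrite inE // => /eqP->.
  rewrite big_cons; split=> [|y].
    case: leP => _; first by rewrite !inE eqxx orbT.
    by move: IHin; rewrite !inE => /orP[->|->]; rewrite ?orbT.
  rewrite ge_min !inE => /or3P[/eqP->|/eqP->|ys]; rewrite ?lexx //.
    by rewrite IHle ?inE ?eqxx ?orbT.
  by rewrite IHle ?inE ?ys ?orbT.
move=> s_n0; have [min_in min_le] := bigP (head 0 s); split.
  move: min_in; rewrite inE => /predU1P[|//]; rewrite /seq_min => ->.
  by case: s s_n0 {bigP min_le} => // x s _; rewrite inE eqxx.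
by move=> x xs; apply: min_le; rewrite inE xs orbT.
Qed.

Definition path_slacks (ps : seq (R * seq R)) : seq R :=
  [seq p.1 - \sum_(d <- p.2) d | p <- ps].

Lemma path_slacks_cons (d : R) (ps : seq (R * seq R)) :
  path_slacks [seq (p.1, d :: p.2) | p <- ps]
  = [seq x - d | x <- path_slacks ps].
Proof.
rewrite /path_slacks -!map_comp; apply: eq_map => p /=.
by rewrite big_cons opprD addrCA addrC.
Qed.

Lemma tree_forest_slackP :
  (forall t (a : tree_cand t),
      is_min (tree_slack a) (path_slacks (tree_paths B a)))
  /\ (forall ws (a : cand ws) (d : R),
      is_min (forest_slack a - d) (path_slacks (forest_paths B d a))).
Proof.
apply: tree_forest_ind => [cap rat []|f ws IHws [o a]|e t IHt a d
                          |e t IHt ws IHws [a1 a2] d].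
- rewrite /path_slacks /= big_nil subr0.
  by split=> [|x]; rewrite inE // => /eqP->.
- exact: IHws.
- rewrite /= path_slacks_cons.
  rewrite -addrA -opprD [_ + d]addrC; exact/is_min_sub/IHt.
rewrite /= addr_minl /path_slacks map_cat; apply: is_min_cat; last exact: IHws.
rewrite -/(path_slacks _) path_slacks_cons.
rewrite -addrA -opprD [_ + d]addrC; exact/is_min_sub/IHt.
Qed.

Lemma slackE ws (a : cand ws) : slack B a = forest_slack a.
Proof.
have := tree_forest_slackP.2 ws a 0; rewrite subr0 => min_a.
apply: (is_min_uniq _ min_a); apply: seq_min_is_min.
by apply/eqP => ps0; case: min_a; rewrite /path_slacks ps0.
Qed.

Fixpoint tree_choices t : tree_cand t -> seq (option nat) :=
  match t return tree_cand t -> seq (option nat) with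
  | Sink _ _ => fun=> [::]
  | Internal f ws => fun a =>
      (if f == set0 then [::] else [:: omap (fun i => val (val i)) a.1])
      ++ forest_choices a.2
  end
with forest_choices ws : cand ws -> seq (option nat) :=
  match ws return cand ws -> seq (option nat) with
  | Last e t => @tree_choices t
  | More e t ws' => fun a => tree_choices a.1 ++ forest_choices a.2
  end.

Lemma encode_choice_none f (o : option {i : 'I_b | i \in f}) :
  f = set0 -> encode_choice R o = VInl VUnit.
Proof.
by case: o => // -[i i_f] f0; have := in_set0 i; rewrite -f0 i_f.
Qed.

Lemma encode_choiceE f (o : option {i : 'I_b | i \in f}) :
  encode_choice R o = enc_option (omap (fun i => val (val i)) o).
Proof. by case: o. Qed.

Lemma encode_set0 : encode_set R (set0 : {set 'I_b}) = VInl VUnit.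
Proof. by rewrite /encode_set enum_set0. Qed.

Lemma encode_set_n0 f : f != set0 ->
  exists v w, encode_set R f = VInr (VPair v w).
Proof.
rewrite /encode_set; case E: (enum f) => [|i s] /=; last by do 2!eexists.
by move/eqP; case; apply/setP => i; rewrite inE -mem_enum E.
Qed.

Definition enc_choices (l : seq (option nat)) : value R :=
  VList (map enc_option l).

Lemma tree_forest_cand_runs :
  (forall t (a : tree_cand t) l,
     runs_in [:: VPair (encode_tree t) (enc_choices (tree_choices a ++ l))]
       tree_cand_body (VPair (encode_tree_cand a) (enc_choices l))
       (200 * tree_size t - 100))
  /\ (forall ws (a : cand ws) l,
     runs_in [:: VPair (VList (encode_forest ws))
                   (enc_choices (forest_choices a ++ l))]
       forest_cand_body (VPair (VList (encode_cands a)) (enc_choices l))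
       (200 * forest_size ws)).
Proof.
apply: tree_forest_ind => [cap rat [] l|f ws IHws [o a] l|e t IHt a l
                          |e t IHt ws IHws [a1 a2] l].
- by run_body_eq.
- have {}IHws := IHws a l; case: (eqVneq f set0) => [f0|f_n0].
    have f_nil : encode_set R f = VInl VUnit by rewrite f0 encode_set0.
    move: IHws; rewrite /= (encode_choice_none o f0) f_nil {1}f0 eqxx /=.
    move=> IHws.
    by run_body_eq => //=; lia.
  have [v [w f_cons]] := encode_set_n0 f_n0.
  move: IHws; rewrite /= encode_choiceE f_cons (negPf f_n0) /= => IHws.
  by run_body_eq => //=; lia.
- have {}IHt := IHt a l.
  have t_gt0 : (0 < tree_size t)%N by case: t {a IHt}.
  by run_body_eq => //=; lia.
have {}IHws := IHws a2 l; have {}IHt := IHt a1 (forest_choices a2 ++ l).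
have t_gt0 : (0 < tree_size t)%N by case: t {a1 IHt}.
rewrite /= -catA.
case: ws a2 IHws IHt => [e' t' a2|e' t' ws a2] IHws IHt.
  by run_body_eq => //=; lia.
by run_body_eq => //=; lia.
Qed.

Lemma flatten_runs (p : plan) l :
  runs_in [:: VPair (enc_plan p) (enc_choices l)] flatten_body
    (enc_choices (choices p ++ l)) (30 * plan_size p).
Proof.
elim: p l => [|o p IHp|p1 IH1 p2 IH2] l; first by run_body_eq.
  have {}IHp := IHp l.
  by run_body_eq => //=; lia.
have {}IH2 := IH2 l; have {}IH1 := IH1 (choices p2 ++ l).
by rewrite /= -catA; run_body => //=; lia.
Qed.

End Slack.

(** * Correctness and running time *)

Section Covers.
Variables (R : realFieldType) (T : Type).
Implicit Types (q c : T -> R) (ch : T -> seq (option nat)) (L : seq (item R)).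

Definition covers q c ch L : Prop :=
  (forall x, x \in L ->
     exists a, [/\ q a = x.1.1, c a = x.1.2 & ch a = choices x.2])
  /\ (forall a, exists2 x, x \in L & q a <= x.1.1 /\ x.1.2 <= c a).

Lemma covers_delay q c ch L (e : edge R) : 0 <= edge_R e ->
  covers q c ch L ->
  covers (fun a => q a - edge_delay e (c a)) (fun a => edge_C e + c a) ch
    (map (delay_item e) L).
Proof.
move=> e_ge0 [sound complete]; split=> [_ /mapP[x xL ->]|a].
  by have [a [qa ca cha]] := sound x xL; exists a; rewrite /= qa ca cha.
have [x xL [le_q le_c]] := complete a.
exists (delay_item e x); first exact: map_f.
rewrite /= lerD2l; split=> //; apply: lerB => //.
by apply: ler_wpM2l => //; rewrite lerD2l.
Qed.

End Covers.

Lemma covers_union (R : realFieldType) (T1 T2 : Type)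
    (q1 c1 : T1 -> R) (q2 c2 : T2 -> R) ch1 ch2 (L1 L2 L : seq (item R)) :
  covers q1 c1 ch1 L1 -> covers q2 c2 ch2 L2 -> union_of L1 L2 L ->
  covers (fun a : T1 * T2 => Num.min (q1 a.1) (q2 a.2))
    (fun a => c1 a.1 + c2 a.2) (fun a => ch1 a.1 ++ ch2 a.2) L.
Proof.
move=> [sound1 complete1] [sound2 complete2] [sound complete].
split=> [x /sound[x1 [x2 [x1L x2L [-> -> ->]]]]|[a1 a2]].
  have [a1 [<- <- <-]] := sound1 x1 x1L.
  by have [a2 [<- <- <-]] := sound2 x2 x2L; exists (a1, a2).
have [x1 x1L [le_q1 le_c1]] := complete1 a1.
have [x2 x2L [le_q2 le_c2]] := complete2 a2.
have [x xL [le_q le_c]] := complete x1 x2 x1L x2L; exists x => //.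
split; last by apply: (le_trans le_c); apply: lerD.
apply: le_trans le_q; rewrite le_min !ge_min /=.
by rewrite le_q1 le_q2 orbT.
Qed.

Section Solve.
Variables (R : realFieldType) (b : nat) (B : 'I_b -> buffer R).
Hypothesis srtB : sorted_library B.
Hypothesis B_ge0 : forall i : 'I_b, 0 <= buf_R (B i).
Implicit Types (t : tree R b) (ws : forest R b) (f : {set 'I_b}) (z : sol R).

Lemma covers_internal0 f ws L : f = set0 ->
  covers (@forest_slack _ _ B ws) (@load _ _ B ws) (@forest_choices _ _ ws) L ->
  covers (@tree_slack _ _ B (Internal f ws)) (@down_cap _ _ B (Internal f ws))
    (@tree_choices _ _ (Internal f ws)) L.
Proof.
move=> f0 [sound complete]; split=> [x /sound[a [qa ca cha]]|[[[i i_f]|] a]] /=.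
- by exists (None, a); rewrite /= subr0 qa ca cha f0 eqxx.
- by have := in_set0 i; rewrite -f0 i_f.
by rewrite subr0; apply: complete.
Qed.

Lemma covers_insertion f ws L N : f != set0 -> insertion_of B f L N ->
  covers (@forest_slack _ _ B ws) (@load _ _ B ws) (@forest_choices _ _ ws) L ->
  covers (@tree_slack _ _ B (Internal f ws)) (@down_cap _ _ B (Internal f ws))
    (@tree_choices _ _ (Internal f ws)) N.
Proof.
move=> f_n0 [soundN [unbufN bufN]] [sound complete]; split.
  move=> x /soundN[y /sound[a [qa ca cha]] [->|[j jf ->]]].
    by exists (None, a); rewrite /= (negPf f_n0) subr0 qa ca cha.
  exists (Some (exist _ j jf), a).
  by rewrite /= (negPf f_n0) qa ca cha.
move=> [[[j jf]|] a]; have [y yL [le_q le_c]] := complete a; last first.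
  exists (unbuffered y); first exact: unbufN.
  by rewrite /= subr0.
have [x xN [le_x eq_c]] := bufN y j yL jf; exists x => //=.
rewrite eq_c; split=> //; apply: le_trans le_x; rewrite /=.
by apply: lerB => //; rewrite lerD2r; apply: ler_wpM2l.
Qed.

Definition bounded_sol (n : nat) z : Prop :=
  if z is Multi L _ _ _ _ then
    [/\ (0 < n)%N, (0 < size L <= b * n + 1)%N
      & forall x, x \in L -> (plan_size x.2 <= 4 * n - 1)%N]
  else n = 0.

Lemma bounded_size_items n z :
  bounded_sol n z -> (0 < size_items z <= b * n + 1)%N.
Proof. by case: z => [q c|L ls s d c] => [->|[]] //=; rewrite muln0. Qed.

Lemma bounded_plan_size n z x : bounded_sol n z -> x \in items z ->
  (plan_size x.2 <= 4 * n - 1 + (n == 0))%N.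
Proof.
case: z => [q c|L ls s d c] /= => [->|[n_gt0 _ le_n]].
  by rewrite inE => /eqP->.
by move=> /mapP[y /le_n le_y ->] /=; lia.
Qed.

Lemma bounded_wire n z (e : edge R) :
  bounded_sol n z -> bounded_sol n (wire e z).
Proof. by case: z. Qed.

Lemma bounded_cap n z (q c : R) : bounded_sol n z -> bounded_sol n (cap q c z).
Proof. by case: z. Qed.

Lemma bounded_union n1 n2 z1 z2 : bounded_sol n1 z1 -> bounded_sol n2 z2 ->
  bounded_sol (n1 + n2) (union z1 z2).
Proof.
case: z1 => [q1 c1|L1 ls1 s1 d1 c1]; first by move=> ->; apply: bounded_cap.
case: z2 => [q2 c2|L2 ls2 s2 d2 c2] bd1.
  by move=> ->; rewrite addn0; apply: bounded_cap.
move=> bd2; have [n1_gt0 _ _] := bd1; have [n2_gt0 _ _] := bd2.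
have := bounded_size_items bd1; have := bounded_size_items bd2.
have pl1 := bounded_plan_size bd1; have pl2 := bounded_plan_size bd2.
rewrite -!size_itemsE /union; set L1' := items _ in pl1 *.
set L2' := items _ in pl2 *; clearbody L1' L2' => sz2 sz1; split.
- by rewrite addn_gt0 n1_gt0.
- rewrite size_join_gt0 ?(andP sz1).1 ?(andP sz2).1 //=.
  by have := size_join L1' L2'; lia.
move=> x xJ; have [x1 [x2 [x1L x2L ->]]] := mem_join xJ.
by have := pl1 _ x1L; have := pl2 _ x2L; rewrite /=; lia.
Qed.

(* The number of pending lines acts as a potential: a line is created in
   constant time, and is paid for when the list is evaluated. *)
Definition solves (T : Type) (q c : T -> R) (ch : T -> seq (option nat))
    (n A : nat) (input : value R) (body : exp) : Prop :=
  exists z, [/\ wf_sol z, bounded_sol n z, covers q c ch (items z)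
    & exists2 m, runs_in [:: input] body (enc_sol z) m
      & (m + 2000 * size_lines z <= A + 4000 * (b * n ^ 2))%N].

Variable order : seq 'I_b.
Hypothesis orderP : library_order B order.

Lemma solve_runs :
  (forall t, tree_res_ge0 t ->
     solves (@tree_slack _ _ B t) (@down_cap _ _ B t) (@tree_choices _ _ t)
       (tree_positions t) (4000 * tree_size t - 3000)
       (VPair (enc_context B order) (encode_tree t)) tree_body)
  /\ (forall ws, res_ge0 ws ->
     solves (@forest_slack _ _ B ws) (@load _ _ B ws) (@forest_choices _ _ ws)
       (num_positions ws) (4000 * forest_size ws)
       (VPair (enc_context B order) (VList (encode_forest ws))) forest_body).
Proof.
apply: tree_forest_ind => [c q _|f ws IHws res|e t IHt res
                          |e t IHt ws IHws res].
- exists (Single q c); split=> //.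
    split=> [x|[]]; first by rewrite inE => /eqP->; exists tt.
    by exists (q, c, NoChoice); rewrite ?inE.
  by eexists; [unfold tree_body; run | rewrite /=; lia].
- have {IHws} [z [wfz bdz covz [m run_z le_m]]] := IHws res.
  case: (eqVneq f set0) => [f0|f_n0].
    have eq_n : tree_positions (Internal f ws) = num_positions ws.
      by rewrite /= f0 eqxx.
    exists z; split; rewrite ?eq_n //; first exact: covers_internal0.
    have f_nil : encode_set R f = VInl VUnit by rewrite f0 encode_set0.
    rewrite /= f_nil; eexists; first by unfold tree_body; run.
    by lia.
  have /andP[sz_gt0 sz_le] := bounded_size_items bdz.
  have [N [insN srtN /andP[szN1 szN2] run_N]] :=
    position_runs f srtB orderP wfz sz_gt0.
  have itemsN : items (Multi N [::] 0 0 0) = N.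
    by rewrite /= (eq_map (@shift_nil R)) map_id.
  have b_gt0 : (0 < b)%N.
    by have [i _] := set0Pn _ f_n0; apply: leq_ltn_trans (ltn_ord i).
  have -> : tree_positions (Internal f ws) = (1 + num_positions ws)%N.
    by rewrite /= f_n0.
  set n := num_positions ws in bdz sz_le le_m *.
  have eq_n : (b * (1 + n) ^ 2 = b * n ^ 2 + 2 * (b * n) + b)%N.
    by rewrite sqrnD; lia.
  exists (Multi N [::] 0 0 0); split.
  + by rewrite /= srtN.
  + split; [by [] | by rewrite (leq_trans sz_gt0) //=; lia |].
    move=> x /insN.1[y yL] eq_x.
    have -> : plan_size x.2 = (plan_size y.2).+1 by case: eq_x => [->|[j _ ->]].
    by have := bounded_plan_size bdz yL; rewrite -/n; lia.
  + by rewrite itemsN; apply: covers_insertion insN covz.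
  have [v [w f_cons]] := encode_set_n0 R f_n0.
  rewrite /= f_cons; rewrite f_cons in run_N.
  eexists; first by unfold tree_body; run.
  by rewrite eq_n /=; lia.
- have /andP[e_ge0 res_t] := res.
  have {IHt} [z [wfz bdz covz [m run_z le_m]]] := IHt res_t.
  have edge_z := edge_runs e z.
  exists (wire e z); split; [exact: wf_wire | exact: bounded_wire | |].
    by rewrite items_wire; apply: covers_delay.
  eexists; first by unfold forest_body; run.
  have : (0 < tree_size t)%N by case: (t).
  by case: z {wfz bdz covz run_z edge_z} le_m => /=; lia.
have /and3P[e_ge0 res_t res_ws] := res.
have {IHt} [z1 [wf1 bd1 cov1 [m1 run1 le_m1]]] := IHt res_t.
have {IHws} [z2 [wf2 bd2 cov2 [m2 run2 le_m2]]] := IHws res_ws.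
have edge_z := edge_runs e z1.
have wfw := wf_wire e_ge0 wf1; have bdw := bounded_wire e bd1.
have covw := covers_delay e_ge0 cov1; rewrite -items_wire in covw.
have lines_w : size_lines (wire e z1) = size_lines z1 by case: (z1).
have union_z := union_runs wfw wf2.
exists (union (wire e z1) z2); split.
- exact: wf_union.
- exact: bounded_union.
- exact: covers_union covw cov2 (union_of_items wfw wf2).
set v1 := wire e z1 in wfw bdw covw union_z edge_z lines_w *.
have eq_ws : encode_forest (More e t ws)
    = VPair (encode_edge e) (encode_tree t) :: encode_forest ws by [].
have [x [l ws_cons]] : exists x l, encode_forest ws = x :: l.
  by case: (ws) => *; do 2!eexists.
rewrite eq_ws; rewrite ws_cons in run2 *.
eexists; first by unfold forest_body; run.
have t_gt0 : (0 < tree_size t)%N by case: (t).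
have /andP[_ sz1] := bounded_size_items bdw.
have /andP[_ sz2] := bounded_size_items bd2.
rewrite [forest_size _]/= [num_positions _]/=.
move: le_m1 le_m2 bdw bd2 sz1 sz2; rewrite -lines_w.
set n1 := tree_positions t; set n2 := num_positions ws.
move=> le_m1 le_m2 bdw bd2 sz1 sz2.
have eq_n : (b * (n1 + n2) ^ 2
             = b * n1 ^ 2 + b * n2 ^ 2 + 2 * (b * n1 * n2))%N.
  by rewrite sqrnD; lia.
rewrite eq_n; clear - bdw bd2 sz1 sz2 le_m1 le_m2 t_gt0.
case: v1 bdw sz1 le_m1 => [q1 c1|L1 ls1 s1 d1 c1] bdw sz1 le_m1.
  by case: z2 bd2 sz2 le_m2 => [q2 c2|L2 ls2 s2 d2 c2] /= *; lia.
case: z2 bd2 sz2 le_m2 => [q2 c2|L2 ls2 s2 d2 c2] bd2 sz2 le_m2.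
  by move: le_m1 le_m2 => /=; lia.
have [n1_gt0 _ _] := bdw; have [n2_gt0 _ _] := bd2.
have le1 : (b * n1 <= b * n1 * n2)%N by rewrite leq_pmulr.
have le2 : (b * n2 <= b * n1 * n2)%N by rewrite mulnAC leq_pmulr.
by move: le_m1 le_m2 sz1 sz2 => /=; lia.
Qed.

Lemma best_runs (x : item R) (l : seq (item R)) :
  exists2 y, y \in x :: l /\ {in x :: l, forall x', x'.1.1 <= y.1.1}
  & runs_in [:: VPair (enc_item x) (enc_items l)] best_body (enc_item y)
      (40 * size l + 10).
Proof.
elim: l x => [|x2 l IHl] x1.
  exists x1; first by split=> [|y]; rewrite inE // => /eqP->.
  by run_body_eq => //=; lia.
case: (leP x1.1.1 x2.1.1) => le_x.
  have [y [yl max_y] run_y] := IHl x2; exists y.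
    split=> [|z]; rewrite inE ?yl ?orbT // => /predU1P[->|]; last exact: max_y.
    by apply: (le_trans le_x); apply: max_y; rewrite inE eqxx.
  case: x1 x2 le_x run_y {IHl yl max_y} => [[q1 c1] p1] [[q2 c2] p2] /=.
  by move=> le_x run_y; run_body_eq => //=; lia.
have [y [yl max_y] run_y] := IHl x1; exists y.
  split=> [|z]; rewrite !inE.
    by move: yl; rewrite inE => /orP[->|->]; rewrite ?orbT.
  move=> /or3P[/eqP->|/eqP->|zl].
  - by apply: max_y; rewrite inE eqxx.
  - by apply: (le_trans (ltW le_x)); apply: max_y; rewrite inE eqxx.
  - by apply: max_y; rewrite inE zl orbT.
have {le_x} le_x : (x1.1.1 <= x2.1.1) = false by rewrite leNgt le_x.
case: x1 x2 le_x run_y {IHl yl max_y} => [[q1 c1] p1] [[q2 c2] p2] /=.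
by move=> le_x run_y; run_body_eq => //=; lia.
Qed.

End Solve.

Lemma positions_le_size (R : Type) (b : nat) :
  (forall t : tree R b, (tree_positions t <= tree_size t)%N)
  /\ (forall ws : forest R b, (num_positions ws <= forest_size ws)%N).
Proof.
apply: tree_forest_ind => //= [f ws IHws|e t IHt ws IHws]; last exact: leq_add.
by case: (f != set0); rewrite /= ?add1n ?add0n ?ltnS // leqW.
Qed.

Lemma leq_self_mul_log (b : nat) : (b <= 1 + b * trunc_log 2 b)%N.
Proof.
by case: b => [|[|b]] //; apply/leqW/leq_pmulr.
Qed.

Theorem mainTheorem1 :
  exists (P : program) (c : nat),
    forall (R : realFieldType) (b : nat) (B : 'I_b -> buffer R) (T : net R b),
      sorted_library B -> (forall i : 'I_b, 0 <= buf_R (B i)) -> res_ge0 T ->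
      let n := num_positions T in
      exists (a : cand T) (t : nat),
        [/\ runs P (encode_input B T) (encode_cand a) t,
            optimal B a
          & (t <= c * (b * n ^ 2 + num_vertices T + b * trunc_log 2 b))%N].
Proof.
exists buffer_insertion, 4900%N => R b B T srtB B_ge0 res n.
have keys_B : runs_in [:: VPair (encode_library B) (VNat 0)] keys_body
    (VList (map (enc_key B) (enum 'I_b))) (30 * b + 10).
  have := @keys_runs R b B (enum 'I_b) 0.
  by rewrite val_enum_ord size_enum_ord; apply.
have keyP i : exists u w, enc_key B i = VPair u (VPair (VReal (buf_C (B i))) w).
  by do 2!eexists.
have [|order [perm_o srt_o sort_B]] :=
    sort_runs keyP (k := (trunc_log 2 b).+1) (l := enum 'I_b).
  by rewrite size_enum_ord ltnW // trunc_log_ltn.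
have [z [wfz bdz [sound complete] [m solve_T le_m]]] :=
  (solve_runs srtB B_ge0 (conj perm_o srt_o)).2 T res.
rewrite size_enum_ord in sort_B.
have force_z := force_runs wfz.
have /andP[sz_gt0 sz_le] := bounded_size_items bdz.
have plan_le := bounded_plan_size bdz.
rewrite -size_itemsE in sz_gt0 sz_le force_z.
case: (items z) sz_gt0 sz_le force_z plan_le sound complete => // x l _ sz_le.
move=> force_z plan_le sound complete.
have [y [yl max_y] best_y] := best_runs x l.
have [a [qa _ cha]] := sound y yl; exists a.
have flat_y := flatten_runs R y.2 [::].
have cand_a := (tree_forest_cand_runs R b).2 T a [::].
rewrite cats0 in flat_y; rewrite cats0 cha in cand_a.
have le_y := plan_le y yl.
have le_n := (positions_le_size R b).2 T.
suff [t run_t le_t] : runs_in [:: encode_input B T] (Call 0 (Var 0))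
    (encode_cand a)
    (4900 * (b * n ^ 2 + num_vertices T + b * trunc_log 2 b)).
  exists t; split=> // a'; rewrite !slackE qa.
  have [x' x'l [le_q _]] := complete a'.
  by apply: (le_trans le_q); apply: max_y.
case: y {yl max_y qa cha} best_y flat_y cand_a le_y => [[qy cy] py] /=.
move=> best_y flat_y cand_a le_y.
have le_b := leq_self_mul_log b.
have le_bn : (b * n <= b * n ^ 2)%N.
  by rewrite leq_mul // -mulnn; case: (n) => // k; apply: leq_pmulr.
have mul_b : (b * (trunc_log 2 b).+1 = b * trunc_log 2 b + b)%N.
  exact: mulnSr.
rewrite mul_b in sort_B.
suff run_main : runs_in [:: encode_input B T] main_body (encode_cand a)
    (4900 * (b * n ^ 2 + num_vertices T + b * trunc_log 2 b) - 10).
  by eapply runs_in_le; [run | rewrite /num_vertices; lia].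
rewrite /encode_input.
by run_body; rewrite /num_vertices; move: sz_le => /=; lia.
Qed.
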